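(* Let $\{T_{ij}\}_{0\le i<j\le n}$, $n\ge2$, be a tableau diagram for rank conditions $r$, and let $(W_1,\dots,W_n)$ be tableaux such that each $W_i$ contains $T_{i-1,i}$ in its upper-left corner. For each $i$ let $W_i=Q_{i-1}\cdot T_{i-1,i}\cdot P_i$ be any simple factorization of $W_i$ with respect to the rectangle $R_{i-1,i}$ (i.e. $(b_{i-1,i})^{a_{i-1,i}}$). Then $(W_1,\dots,W_n)$ is a factor sequence of $\{T_{ij}\}$ if and only if $Q_0$ and $P_n$ are empty and $(P_1\cdot Q_1,\dots,P_{n-1}\cdot Q_{n-1})$ is a factor sequence of the array $\{T'_{ij}\}_{0\le i<j\le n-1}$, $T'_{ij}=T_{i,j+1}$ (the bottom $n-1$ rows of the tableau diagram).
   Context: Rank conditions: nonnegative integers $r_{ij}$, $0\le i\le j\le n$, with $r_{ij}\le\min(r_{i,j-1},r_{i+1,j})$ for $i<j$ and $r_{ij}-r_{i,j-1}-r_{i+1,j}+r_{i+1,j-1}\ge0$ for $j-i\ge2$. For $i<j$, $a_{ij}=r_{i+1,j}-r_{ij}$, $b_{ij}=r_{i,j-1}-r_{ij}$, and $R_{ij}$ is the rectangle $(b_{ij})^{a_{ij}}$ with $a_{ij}$ rows and $b_{ij}$ columns (possibly empty, but $a_{ij},b_{ij}$ are still recorded). Tableaux are semistandard Young tableaux with integer entries (the empty tableau allowed); $T\cdot U$ is the product of tableaux (row-insert into $T$ the row reading word of $U$, rows read left to right from bottom to top); a factorization $W=P\cdot Q$ means tableaux $P,Q$ with product $W$. A tableau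 diagram for $r$ is a family $\{T_{ij}\}$, $T_{ij}$ of shape $R_{ij}$, with every entry of $T_{ij}$ strictly larger than every entry of $T_{kl}$ whenever $i\le k<l\le j$, $(k,l)\ne(i,j)$. Factor sequences of a triangular array $\{T_{ij}\}_{0\le i<j\le m}$: for $m=1$ only $(T_{01})$; for $m\ge2$, all sequences $(T_{01}\cdot P_1,\;Q_1\cdot T_{12}\cdot P_2,\dots,Q_{m-1}\cdot T_{m-1,m})$ where $(U_1,\dots,U_{m-1})$ is a factor sequence of $\{T_{i,j+1}\}_{0\le i<j\le m-1}$ and $U_i=P_i\cdot Q_i$ are arbitrary factorizations. Let $a,b\ge0$ and $T$ a tableau of shape $(b)^a$. A tableau $W$ contains $T$ in its upper-left corner if the shape of $W$ contains $(b)^a$ and the entries of $W$ in it form $T$. Then let $Q_0$ be the part of $W$ in rows $>a$ and columns $\le b$, $P_0$ the part in rows $\le a$ and columns $>b$, and $Z$ the part in rows $>a$ and columns $>b$ (each translated to a straight-shape tableau). A simple factorization of $W$ with respect to $(b)^a$ is a factorization $W=Q\cdot T\cdot P$ such that $Q=Q_0\cdot\tilde Q$ and $P=\tilde P\cdot P_0$ for some factorization $Z=\tilde Q\cdot\tilde P$. (E.g. the canonical factorization: $Q$ = rows of $W$ below row $a$, $P=P_0$.) *)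

(* Defs.v *)
From mathcomp Require Import all_boot all_order all_algebra.

Set Implicit Arguments.
Unset Strict Implicit.
Unset Printing Implicit Defensive.

(** A filling is the list of its rows, from top to bottom.  Since a tableau has
    no empty row, every semistandard Young tableau of straight shape is
    represented by exactly one filling; the empty tableau is [[::]]. *)
Definition filling := seq (seq int).

(** [zip] truncates, so only the cells of [u] lying above [v] are compared. *)
Definition above (u v : seq int) : bool :=
  (size v <= size u) && all (fun p => p.1 < p.2)%R (zip u v).

Definition is_tableau (T : filling) : bool :=
  [&& [::] \notin T, all (sorted (fun x y : int => x <= y)%R) T & sorted above T].

Definition shape (T : filling) : seq nat := map size T.

(** The partition (b)^a has no zero part: it is empty when [a] or [b] is 0. *)
Definition rect (a b : nat) : seq nat := [seq p <- nseq a b | 0 < p].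

(** Row insertion: [x] bumps the leftmost entry strictly larger than [x]. *)
Fixpoint row_insert (T : filling) (x : int) : filling :=
  if T is u :: T' then
    let k := find (fun y => x < y)%R u in
    if k < size u then set_nth 0%R u k x :: row_insert T' (nth 0%R u k)
    else rcons u x :: T'
  else [:: [:: x]].

Definition reading_word (U : filling) : seq int := flatten (rev U).

Definition tprod (T U : filling) : filling := foldl row_insert T (reading_word U).

Notation "T ** U" := (tprod T U) (at level 40, left associativity).

Definition factorization (W P Q : filling) : Prop :=
  [/\ is_tableau P, is_tableau Q & W = P ** Q].

(** Only the values [r i j] with [i <= j <= n] are meaningful. *)
Definition rank_conditions (n : nat) (r : nat -> nat -> nat) : Prop :=
  (forall i j, i < j <= n -> r i j <= minn (r i j.-1) (r i.+1 j)) /\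
  (forall i j, i.+2 <= j <= n ->
     r i j.-1 + r i.+1 j <= r i j + r i.+1 j.-1).

(** Under [rank_conditions] these truncated differences are genuine ones. *)
Definition rect_rows (r : nat -> nat -> nat) (i j : nat) : nat := r i.+1 j - r i j.
Definition rect_cols (r : nat -> nat -> nat) (i j : nat) : nat := r i j.-1 - r i j.

(** An array (T_ij)_{0 <= i < j <= m} is a function of [i] and [j] of which only
    the values with [i < j <= m] are meaningful. *)
Definition tableau_diagram (n : nat) (r : nat -> nat -> nat)
    (T : nat -> nat -> filling) : Prop :=
  (forall i j, i < j <= n ->
     is_tableau (T i j) /\
     shape (T i j) = rect (rect_rows r i j) (rect_cols r i j)) /\
  (forall i k l j, i <= k -> k < l -> l <= j -> j <= n -> (k, l) <> (i, j) ->
     forall x y, x \in flatten (T i j) -> y \in flatten (T k l) -> (y < x)%R).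

Definition bottom_rows (T : nat -> nat -> filling) : nat -> nat -> filling :=
  fun i j => T i j.+1.

(** A sequence (W_1, ..., W_m) is a function of which only the values at
    1, ..., m are meaningful.  In the recursive clause the first and last terms
    T_01 . P_1 and Q_(m-1) . T_(m-1,m) are covered by the general term, with
    [Q 0] and [P m] the empty tableau. *)
Fixpoint factor_sequence (m : nat) (T : nat -> nat -> filling)
    (W : nat -> filling) {struct m} : Prop :=
  match m with
  | 0 => False
  | 1 => W 1 = T 0 1
  | (_.+1 as m').+1 =>
      exists U P Q : nat -> filling,
        [/\ factor_sequence m' (bottom_rows T) U,
            forall i, 1 <= i <= m' -> factorization (U i) (P i) (Q i),
            Q 0 = [::], P m = [::] &
            forall i, i < m -> W i.+1 = Q i ** T i i.+1 ** P i.+1]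
  end.

(** Translation to a straight shape of a part of a tableau cut out in rows:
    empty rows are discarded. *)
Definition straighten (W : filling) : filling := [seq u <- W | ~~ nilp u].

Definition upper_left (a b : nat) (W : filling) := straighten (map (take b) (take a W)).
Definition lower_left (a b : nat) (W : filling) := straighten (map (take b) (drop a W)).
Definition upper_right (a b : nat) (W : filling) := straighten (map (drop b) (take a W)).
Definition lower_right (a b : nat) (W : filling) := straighten (map (drop b) (drop a W)).

(** Rows beyond the last one have length 0. *)
Definition contains_upper_left (a b : nat) (T W : filling) : Prop :=
  (forall i, i < a -> b <= size (nth [::] W i)) /\ upper_left a b W = T.

Definition simple_factorization (a b : nat) (T W Q P : filling) : Prop :=
  [/\ is_tableau Q, is_tableau P, W = Q ** T ** P &
      exists Q' P' : filling,
        [/\ factorization (lower_right a b W) Q' P',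
            Q = lower_left a b W ** Q' & P = P' ** upper_right a b W]].

(* Main.v *)
(** Idea: say that (U_1, ..., U_m) is a factor sequence.  If U_i = A . X and the
    first b_(i-1,i) columns of U_i are those of A, then X may be moved to the
    next term, giving (..., A, X . U_(i+1), ...); dually, if U_i = X . A and the
    first a_(i-1,i) rows of U_i are those of A, then X may be moved to
    U_(i-1).  Now let W_i = Q . T . P with T rectangular of shape (b)^a and with
    entries smaller than those of Q and P.  Cut Q after column b and move its
    right part, which passes through T, into P; then cut P below row a and move
    its lower part, which passes through T, into Q.  The result is the canonical
    factorization of W_i, and another move to the right reaches any simple one.
    Since the rectangles shrink along the diagram, the effect of these two moves
    on the products P_i . Q_i is exactly one of the moves above for the bottom
    rows, whence an induction on the number of rows.

    The facts on products of tableaux come from the plactic monoid.  What is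
    visible for rows under row insertion (the first a rows of a product P . Q
    only depend on the first a rows of P) holds for columns because
    transposition exchanges row insertion and column insertion. *)

From mathcomp Require Import all_boot all_order all_algebra.
From mathcomp Require Import zify.
Require Import Defs.

Set Implicit Arguments.
Unset Strict Implicit.
Unset Printing Implicit Defensive.

Import Order.TTheory.

(** For [s = true], insertion along [cmp s] is row insertion.  For [s = false] it
    is column insertion, a tableau being given by its columns, from left to
    right, and words being read backwards. *)
Definition cmp (s : bool) (x y : int) : bool := if s then (x < y)%R else (x <= y)%R.

Lemma cmpN s x y : cmp (~~ s) x y = ~~ cmp s y x.
Proof. by case: s; rewrite /cmp /=; lia. Qed.

Lemma cmp_trans s : transitive (cmp s).
Proof. by move=> y x z; case: s; rewrite /cmp; lia. Qed.

Lemma cmp_transN s x y z : cmp s x y -> ~~ cmp s z y -> cmp s x z.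
Proof. by case: s; rewrite /cmp; lia. Qed.

Lemma cmp_Ntrans s x y z : ~~ cmp s y x -> cmp s y z -> cmp s x z.
Proof. by case: s; rewrite /cmp; lia. Qed.

Lemma Ncmp_trans s x y z : ~~ cmp s y x -> ~~ cmp s z y -> ~~ cmp s z x.
Proof. by case: s; rewrite /cmp; lia. Qed.

Lemma cmp_asymN s x y z : cmp s x y -> ~~ cmp s z y -> ~~ cmp s z x.
Proof. by case: s; rewrite /cmp; lia. Qed.

(** The order [cmp (~~ s)] is the negation of the converse of [cmp s]: rows increase weakly for
    [s = true] and strictly for [s = false]. The form by [pairwise] splits along concatenations. *)
Definition row_sorted s (u : seq int) := pairwise (cmp (~~ s)) u.

Lemma row_sortedE s u : row_sorted s u = sorted (cmp (~~ s)) u.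
Proof. by rewrite /row_sorted sorted_pairwise //; exact: cmp_trans. Qed.

(** * Insertion *)

Section Insertion.

Variable s : bool.
Implicit Types (u v w p q : seq int) (x y z : int) (T : filling).

(** The bumped letter is returned as a word of length at most one, so that folding insertion over it
    either continues in the next row or stops. *)
Definition bump u x : seq int * seq int :=
  let k := find (cmp s x) u in
  if k < size u then (set_nth 0%R u k x, [:: nth 0%R u k]) else (rcons u x, [::]).

(** For [s = true] this is convertible to [row_insert]; results on [product true] are carried over
    to [**] in this way. *)
Fixpoint insert T x : filling :=
  if T is u :: T' then
    let k := find (cmp s x) u in
    if k < size u then set_nth 0%R u k x :: insert T' (nth 0%R u k)
    else rcons u x :: T'
  else [:: [:: x]].

(** The effect on one row [u] of inserting the word [w]: the final row, and the
    word of the bumped letters, which is inserted into the next row. *)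
Fixpoint pass u w : seq int * seq int :=
  if w is x :: w' then
    ((pass (bump u x).1 w').1, (bump u x).2 ++ (pass (bump u x).1 w').2)
  else (u, [::]).

Notation le_all u x := (all (fun y => ~~ cmp s x y) u).

Lemma bump_in u y v x :
  le_all u x -> cmp s x y -> bump (u ++ y :: v) x = (u ++ x :: v, [:: y]).
Proof.
move=> ux xy; have fk : find (cmp s x) (u ++ y :: v) = size u.
  rewrite find_cat /= xy addn0 ifN //.
  by rewrite -all_predC.
rewrite /bump fk size_cat /= -addSnnS leq_addr.
congr (_, [:: _]); last by rewrite nth_cat ltnn subnn.
by elim: u {ux fk} => //= t u ->.
Qed.

Lemma bump_out u x : le_all u x -> bump u x = (rcons u x, [::]).
Proof.
move=> ux; have /hasNfind fk : ~~ has (cmp s x) u by rewrite -all_predC.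
by rewrite /bump fk ltnn.
Qed.

Variant bump_spec u x : seq int * seq int -> Type :=
  | BumpOut of le_all u x : bump_spec u x (rcons u x, [::])
  | BumpIn p y q of u = p ++ y :: q & le_all p x & cmp s x y :
      bump_spec u x (p ++ x :: q, [:: y]).

Lemma bumpP u x : bump_spec u x (bump u x).
Proof.
have [ux|ux] := boolP (has (cmp s x) u); last first.
  by rewrite bump_out ?all_predC //; constructor; rewrite all_predC.
have [y p q xy px] := split_find ux.
have px' : le_all p x by rewrite all_predC.
by rewrite cat_rcons bump_in //; apply: BumpIn xy.
Qed.

Lemma insert_cons u T x :
  insert (u :: T) x = (bump u x).1 :: foldl insert T (bump u x).2.
Proof. by rewrite /= /bump; case: ifP. Qed.

Lemma foldl_insert_cons u T w :
  foldl insert (u :: T) w = (pass u w).1 :: foldl insert T (pass u w).2.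
Proof.
elim: w u T => //= x w IH u T.
by rewrite -/(insert (u :: T) x) insert_cons IH foldl_cat.
Qed.

Lemma foldl_insert_nil w :
  w <> [::] -> foldl insert [::] w = (pass [::] w).1 :: foldl insert [::] (pass [::] w).2.
Proof. by case: w => // x w _; rewrite -foldl_insert_cons. Qed.

Lemma pass_cat u w1 w2 :
  pass u (w1 ++ w2) =
  ((pass (pass u w1).1 w2).1, (pass u w1).2 ++ (pass (pass u w1).1 w2).2).
Proof.
elim: w1 u => [|x w1 IH] u /=; first by case: pass.
by rewrite IH /= catA.
Qed.

Lemma bump_perm u x : perm_eq ((bump u x).1 ++ (bump u x).2) (rcons u x).
Proof.
case: bumpP => [_|p y q -> _ _] /=; first by rewrite cats0.
by apply/permP => a; rewrite -!cats1 !count_cat /=; lia.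
Qed.

Lemma pass_perm u w : perm_eq ((pass u w).1 ++ (pass u w).2) (u ++ w).
Proof.
elim: w u => [|x w IH] u //=.
apply/permP => a; have /permP/(_ a) := IH (bump u x).1.
have /permP/(_ a) := bump_perm u x.
by rewrite -cats1 !count_cat /=; lia.
Qed.

Lemma row_sorted_le u v x y :
  row_sorted s (u ++ v) -> x \in u -> y \in v -> ~~ cmp s y x.
Proof.
rewrite /row_sorted pairwise_cat => /andP[/allrelP uv _] xu yv.
by rewrite -cmpN uv.
Qed.

Lemma row_sorted_cat u v :
  row_sorted s (u ++ v) = [&& allrel (cmp (~~ s)) u v, row_sorted s u & row_sorted s v].
Proof. exact: pairwise_cat. Qed.

Lemma row_sorted_cons x u :
  row_sorted s (x :: u) = all (fun y => ~~ cmp s y x) u && row_sorted s u.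
Proof. by rewrite /row_sorted /=; congr andb; apply: eq_all => y; rewrite cmpN. Qed.

Lemma le_all_trans u x y : ~~ cmp s y x -> le_all u x -> le_all u y.
Proof. by move=> xy; apply: sub_all => t /Ncmp_trans; apply. Qed.

Lemma allrel1r_cmp u x : allrel (cmp (~~ s)) u [:: x] = le_all u x.
Proof. by rewrite allrel1r; apply: eq_all => y; rewrite cmpN. Qed.

Lemma allrelr_cmp u v x : allrel (cmp (~~ s)) u (x :: v) =
  le_all u x && allrel (cmp (~~ s)) u v.
Proof.
by rewrite allrel_consr; congr andb; apply: eq_all => y; rewrite cmpN.
Qed.

Lemma bump_sorted u x : row_sorted s u -> row_sorted s (bump u x).1.
Proof.
case: bumpP => [ux su|p y q -> px xy] /=.
  by rewrite -cats1 row_sorted_cat su allrel1r_cmp ux.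
rewrite !row_sorted_cat !allrelr_cmp !row_sorted_cons px /=.
case/and3P => /andP[_ ->] -> /andP[yq ->]; rewrite /= andbT.
by apply: sub_all yq => z; apply: cmp_asymN.
Qed.

Lemma pass_sorted u w : row_sorted s u -> row_sorted s (pass u w).1.
Proof. by elim: w u => //= x w IH u su; apply/IH/bump_sorted. Qed.

End Insertion.

(** * Knuth equivalence and the product *)

Section Knuth.

Variable s : bool.
Implicit Types (u v w p q : seq int) (x y z : int) (T : filling).

(** For [s = true] these are the plactic relations. For [s = false] strict and weak inequalities are
    interchanged, which is the effect of reversing words ([knuth_rev]). *)
Inductive knuth : seq int -> seq int -> Prop :=
  | knuth_refl w : knuth w w
  | knuth_sym w1 w2 : knuth w1 w2 -> knuth w2 w1
  | knuth_trans w2 w1 w3 : knuth w1 w2 -> knuth w2 w3 -> knuth w1 w3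
  | knuth_yzx p q x y z : cmp s x y -> ~~ cmp s z y ->
      knuth (p ++ [:: y; z; x] ++ q) (p ++ [:: y; x; z] ++ q)
  | knuth_xzy p q x y z : ~~ cmp s y x -> cmp s y z ->
      knuth (p ++ [:: x; z; y] ++ q) (p ++ [:: z; x; y] ++ q).

Lemma knuth_cat w1 w2 p q : knuth w1 w2 -> knuth (p ++ w1 ++ q) (p ++ w2 ++ q).
Proof.
elim=> {w1 w2} [w|w1 w2 _ IH|w2 w1 w3 _ IH1 _ IH2|p' q' x y z xy yz|p' q' x y z xy yz].
- exact: knuth_refl.
- exact: knuth_sym.
- exact: knuth_trans IH1 IH2.
- by have := knuth_yzx (p ++ p') (q' ++ q) xy yz; rewrite -!catA.
- by have := knuth_xzy (p ++ p') (q' ++ q) xy yz; rewrite -!catA.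
Qed.

Lemma knuth_catl w1 w2 p : knuth w1 w2 -> knuth (p ++ w1) (p ++ w2).
Proof. by move=> /(knuth_cat p [::]); rewrite !cats0. Qed.

Lemma knuth_catr w1 w2 q : knuth w1 w2 -> knuth (w1 ++ q) (w2 ++ q).
Proof. exact: (@knuth_cat _ _ [::] q). Qed.

Lemma knuth_perm w1 w2 : knuth w1 w2 -> perm_eq w1 w2.
Proof.
elim=> {w1 w2} // [w1 w2 _|w2 w1 w3 _ H1 _ H2|p q x y z _ _|p q x y z _ _].
- by rewrite perm_sym.
- exact: perm_trans H1 H2.
- by apply/permP => a; rewrite !count_cat /=; lia.
- by apply/permP => a; rewrite !count_cat /=; lia.
Qed.

Notation le_all u x := (all (fun y => ~~ cmp s x y) u).

Ltac le_side := rewrite ?all_rcons ?all_cat /= ?all_cat /=; do ?[apply/andP; split => //];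
  rewrite ?andbT //.

Lemma bump_at u1 y u2 u x : u = u1 ++ y :: u2 -> le_all u1 x -> cmp s x y ->
  bump s u x = (u1 ++ x :: u2, [:: y]).
Proof. by move=> ->; apply: bump_in. Qed.

(** Insertions of Knuth equivalent words are compared one row at a time. If [y], [z] and [x] all
    bump a letter, the bumped letters satisfy the inequalities of [knuth_yzx] again; otherwise the
    two bumped words coincide. *)
Lemma pass_yzx u x y z : row_sorted s u -> cmp s x y -> ~~ cmp s z y ->
  (pass s u [:: y; z; x]).1 = (pass s u [:: y; x; z]).1 /\
  knuth (pass s u [:: y; z; x]).2 (pass s u [:: y; x; z]).2.
Proof.
move=> su xy yz; have xz := cmp_asymN xy yz.
rewrite /=; case: (bumpP s u y) => [uy|p y' q def_u py yy'] /=.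
  have uz : le_all u z by apply: le_all_trans uy.
  rewrite (@bump_out _ (rcons u y) z); last by le_side.
  case: (bumpP s u x) => [ux|p x' q def_u px xx'].
    rewrite (@bump_at u y [:: z] _ x) -?cats1 -?catA // (@bump_at u y [::] _ x) //=.
    rewrite (@bump_out _ _ z); last by le_side.
    by rewrite -cats1 -catA; split=> //=; constructor.
  move: uz; rewrite def_u all_cat /= => /and3P[pz _ qz].
  rewrite (@bump_at p x' (q ++ [:: y; z]) _ x) -?cats1 -?catA //.
  rewrite (@bump_at p x' (q ++ [:: y]) _ x) -?cats1 -?catA //=.
  rewrite (@bump_out _ _ z); last by le_side.
  by rewrite -cats1 /= -catA /= -catA; split=> //=; constructor.
have pz : le_all p z by apply: le_all_trans py.
move: su; rewrite def_u row_sorted_cat row_sorted_cons => /and3P[_ _ /andP[y'q _]].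
case: (bumpP s p x) => [px|p1 x' p2 def_p px xx'].
  rewrite (@bump_at p y q (p ++ y :: q) x) //=.
  case: (bumpP s q z) => [qz|q1 z' q2 def_q q1z zz'].
    rewrite (@bump_out _ _ z); last by le_side.
    rewrite (@bump_out _ _ z); last by le_side.
    rewrite (@bump_at p y (q ++ [:: z]) _ x) -?cats1 -?catA //=.
    by split=> //=; constructor.
  rewrite def_q (@bump_at (p ++ y :: q1) z' q2 (p ++ y :: q1 ++ z' :: q2)) -?catA //=;
    last by le_side.
  rewrite (@bump_at p y (q1 ++ z :: q2) _ x) -?catA //=.
  rewrite (@bump_at (p ++ x :: q1) z' q2 _ z) -?catA //=; last by le_side.
  split=> //; apply: (@knuth_yzx [::] [::]) => //.
  by move: y'q; rewrite def_q all_cat /= => /and3P[].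
have x'y' : cmp s x' y'.
  by move: py; rewrite def_p all_cat /= => /and3P[_ x'y _]; apply: cmp_Ntrans x'y yy'.
move: pz; rewrite def_p all_cat /= => /and3P[p1z x'z p2z].
rewrite -!catA /= (@bump_at p1 x' (p2 ++ y :: q) (p1 ++ x' :: p2 ++ y :: q) x) //=.
case: (bumpP s q z) => [qz|q1 z' q2 def_q q1z zz'].
  rewrite (@bump_out _ _ z); last by le_side.
  rewrite (@bump_out _ _ z); last by le_side.
  rewrite (@bump_at p1 x' (p2 ++ y :: q ++ [:: z]) _ x) -?cats1 -?catA //= -?catA //=.
  by split=> //=; constructor.
rewrite def_q (@bump_at (p1 ++ x' :: p2 ++ y :: q1) z' q2 (p1 ++ _)) -?catA //=; last 2 first.
- by rewrite -?catA.
- by le_side.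
rewrite -?catA /= -?catA /=.
rewrite (@bump_at p1 x' (p2 ++ y :: q1 ++ z :: q2) (p1 ++ _) x) //=.
rewrite (@bump_at (p1 ++ x :: p2 ++ y :: q1) z' q2 _ z) -?catA //=; last 2 first.
- by rewrite -?catA.
- by le_side.
split=> //; first by rewrite -?catA.
apply: (@knuth_yzx [::] [::]) => //.
by move: y'q; rewrite def_q all_cat /= => /and3P[].
Qed.

Lemma pass_xzy u x y z : row_sorted s u -> ~~ cmp s y x -> cmp s y z ->
  (pass s u [:: x; z; y]).1 = (pass s u [:: z; x; y]).1 /\
  knuth (pass s u [:: x; z; y]).2 (pass s u [:: z; x; y]).2.
Proof.
move=> su xy yz; have xz : cmp s x z := cmp_Ntrans xy yz.
have zx : ~~ cmp s z x by apply/negP => zx; rewrite (cmp_trans yz zx) in xy.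
rewrite /=; case: (bumpP s u x) => [ux|p x' q def_u px xx'] /=.
  have uy : le_all u y by apply: le_all_trans ux.
  have uz : le_all u z by apply: le_all_trans ux.
  rewrite (bump_out uz) (@bump_out _ (rcons u x) z); last by le_side.
  rewrite (@bump_at u z [::] _ x) -?cats1 //= (@bump_at (u ++ [:: x]) z [::] _ y) -?catA //=;
    last by le_side.
  rewrite (@bump_out _ _ y); last by le_side.
  by rewrite -cats1 -?catA; split=> //=; constructor.
have py : le_all p y by apply: le_all_trans px.
have pz : le_all p z by apply: le_all_trans px.
move: su; rewrite def_u row_sorted_cat row_sorted_cons => /and3P[_ _ /andP[x'q _]].
(* If [z] would bump [x'] as well, the relation changes its type: the bumped words are [x' z' z] and
   [x' z z'], an instance of [knuth_yzx], or they are equal when nothing follows [x']. *)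
have [zx'|zx'] := boolP (cmp s z x').
  rewrite (@bump_at p x' q (p ++ x' :: q) z) //= (@bump_at p z q _ x) //=.
  case: q {def_u} x'q => [|z' q] /= => [_|/andP[x'z' x'q]].
    rewrite (@bump_out _ _ z); last by le_side.
    rewrite (@bump_at (p ++ [:: x]) z [::] _ y) -?cats1 -?catA //=; last by le_side.
    rewrite (@bump_out _ _ y); last by le_side.
    by rewrite -cats1 -?catA; split=> //=; constructor.
  have zz' : cmp s z z' by apply: cmp_transN zx' x'z'.
  rewrite (@bump_at (p ++ [:: x]) z' q _ z) -?catA //=; last by le_side.
  rewrite (@bump_at (p ++ [:: x]) z (q) _ y) -?catA //=; last by le_side.
  rewrite (@bump_at (p ++ [:: x]) z' q _ y) -?catA //=; first last.
  - exact: cmp_trans yz zz'.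
  - by le_side.
  by split=> //; apply: (@knuth_yzx [::] [::]).
case: (bumpP s q z) => [qz|q1 z' q2 def_q q1z zz'].
  rewrite (@bump_out _ _ z); last by le_side.
  rewrite (@bump_out _ _ z); last by le_side.
  rewrite (@bump_at p x' (q ++ [:: z]) _ x) -?cats1 -?catA //=.
  by split=> //=; constructor.
rewrite def_q (@bump_at (p ++ x :: q1) z' q2 _ z) -?catA //=; last by le_side.
rewrite (@bump_at (p ++ x' :: q1) z' q2 _ z) -?catA //=; last by le_side.
rewrite (@bump_at p x' (q1 ++ z :: q2) _ x) //=.
split=> //.
(* No letter of [p] and not [x] either is bumped by [y], so only the rest of the row matters. *)
have -> : (bump s (p ++ x :: q1 ++ z :: q2) y).2 =
          (bump s (q1 ++ z :: q2) y).2.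
  case: (bumpP s (q1 ++ z :: q2) y) => [ay|a y' b -> ay yy'].
    by rewrite bump_out // all_cat py /= xy ay.
  by rewrite (@bump_at (p ++ x :: a) y' b) -?catA //=; le_side.
case: (bumpP s q1 y) => [q1y|a y' b def_q1 ay yy'].
  rewrite (@bump_at q1 z q2) //=.
  by apply: (@knuth_xzy [::] [::]).
rewrite (@bump_at a y' (b ++ z :: q2)) //=; last by rewrite def_q1 -catA.
apply: (@knuth_xzy [::] [::]).
  by move: x'q; rewrite def_q def_q1 !all_cat /= => /andP[/and3P[]].
move: q1z; rewrite def_q1 all_cat /= => /and3P[_ y'z _].
exact: cmp_Ntrans y'z zz'.
Qed.

End Knuth.

(** * The product and its invariance under Knuth equivalence *)

Section Product.

Variable s : bool.
Implicit Types (u v w p q : seq int) (x y z : int) (T P Q : filling).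

Notation le_all u x := (all (fun y => ~~ cmp s x y) u).

Lemma pass_knuth u w1 w2 : row_sorted s u -> knuth s w1 w2 ->
  (pass s u w1).1 = (pass s u w2).1 /\ knuth s (pass s u w1).2 (pass s u w2).2.
Proof.
move=> su H; elim: H u su => {w1 w2}.
- by move=> w u _; split=> //; constructor.
- by move=> w1 w2 _ IH u /IH [-> K]; split=> //; apply: knuth_sym.
- move=> w2 w1 w3 _ IH1 _ IH2 u su.
  by have [[-> K1] [-> K2]] := (IH1 u su, IH2 u su); split=> //; apply: knuth_trans K1 K2.
- move=> p q x y z xy yz u su.
  have [E K] := pass_yzx (pass_sorted p su) xy yz.
  rewrite (pass_cat s u p ([:: y; z; x] ++ q)) (pass_cat s u p ([:: y; x; z] ++ q)).
  rewrite (pass_cat s _ [:: y; z; x] q) (pass_cat s _ [:: y; x; z] q) E.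
  by split=> //; apply: knuth_cat.
- move=> p q x y z xy yz u su.
  have [E K] := pass_xzy (pass_sorted p su) xy yz.
  rewrite (pass_cat s u p ([:: x; z; y] ++ q)) (pass_cat s u p ([:: z; x; y] ++ q)).
  rewrite (pass_cat s _ [:: x; z; y] q) (pass_cat s _ [:: z; x; y] q) E.
  by split=> //; apply: knuth_cat.
Qed.

Definition rows_sorted T := all (row_sorted s) T.

Lemma insert_rows_sorted T x : rows_sorted T -> rows_sorted (insert s T x).
Proof.
elim: T x => [|u T IH] x //; rewrite insert_cons /= => /andP[su sT].
by have := bump_sorted x su; case: bumpP => [_|p y q _ _ _] /= ->; rewrite ?sT ?IH.
Qed.

Lemma pass_neq0 u w : 0 < size u -> 0 < size (pass s u w).1.
Proof.
elim: w u => [|x w IH] u u0 //=; apply: IH.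
by case: bumpP => *; rewrite ?size_rcons ?size_cat ?addnS.
Qed.

Lemma foldl_insert_knuth T w1 w2 : rows_sorted T -> knuth s w1 w2 ->
  foldl (insert s) T w1 = foldl (insert s) T w2.
Proof.
elim: T w1 w2 => [|u T IH] w1 w2; last first.
  rewrite /= => /andP[su sT] K; rewrite !foldl_insert_cons.
  by have [-> K'] := pass_knuth su K; rewrite (IH _ _ sT K').
(* Below the last row the induction is on the length of the word: a newly created row keeps at least
   one letter, so a shorter word is passed on. *)
move=> _; have [n] := ubnP (size w1); elim: n w1 w2 => // n IHn w1 w2 w1n K.
have [w1_0|/eqP w1_0] := eqVneq w1 [::].
  by move: K; rewrite w1_0 => /knuth_perm; rewrite perm_sym => /perm_nilP ->.
have w2_0 : w2 <> [::].
  by move=> w2_0; move: (knuth_perm K); rewrite w2_0 => /perm_nilP.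
rewrite (foldl_insert_nil s w1_0) (foldl_insert_nil s w2_0).
have [-> K'] := @pass_knuth [::] _ _ isT K; congr (_ :: _); apply: IHn K'.
have /perm_size := pass_perm s [::] w1; rewrite size_cat /= => E.
have : 0 < size (pass s [::] w1).1.
  by case: (w1) w1_0 => // x w _ /=; apply: pass_neq0.
lia.
Qed.

Lemma knuth_bump u x : row_sorted s u ->
  knuth s (rcons u x) ((bump s u x).2 ++ (bump s u x).1).
Proof.
case: bumpP => [_ _|p y q -> px xy] /=; first by constructor.
rewrite row_sorted_cat allrelr_cmp row_sorted_cons => /and3P[/andP[py _] sp /andP[yq sq]].
rewrite -cats1 -catA /=.
(* First [x] travels left over [q] by [knuth_yzx], then [y] travels left over [p] by [knuth_xzy]. *)
apply: (@knuth_trans _ (p ++ [:: y, x & q])).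
  apply: knuth_catl.
  elim/last_ind: q yq sq => [_ _|q z IH]; first by constructor.
  rewrite all_rcons -cats1 row_sorted_cat => /andP[yz yq] /and3P[qz sq _].
  have xz : cmp s x z by apply: cmp_transN xy yz.
  apply: (@knuth_trans _ (y :: q ++ [:: x; z])); last first.
    by have := knuth_catr [:: z] (IH yq sq); rewrite /= -!catA.
  rewrite -catA /=; case/lastP: q {IH} yq qz sq => [_ _ _|q z'].
    exact: (@knuth_yzx _ [::] [::]).
  rewrite all_rcons -cats1 allrel1r_cmp all_cat -catA /= => /andP[yz' _] /and3P[_ z'z _] _.
  rewrite -catA; apply: (@knuth_catl _ _ _ (y :: q)).
  by apply: (@knuth_yzx _ [::] [::]) => //; apply: cmp_transN xy yz'.
elim: p px py sp => [_ _ _|z p IH]; first by constructor.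
rewrite row_sorted_cons => /andP[zx px] /andP[zy py] /andP[zp sp].
apply: (@knuth_trans _ [:: z, y & p ++ x :: q]).
  by apply: (@knuth_catl _ _ _ [:: z]); apply: IH.
case: p {IH} px py zp sp => [_ _ _ _|t p] /=.
  by apply: (@knuth_xzy _ [::] q).
move=> /andP[tx _] _ /andP[zt _] _.
apply: (@knuth_xzy _ [::] (p ++ x :: q)) => //.
exact: cmp_Ntrans tx xy.
Qed.

Lemma reading_word_cons u T : reading_word (u :: T) = reading_word T ++ u.
Proof. by rewrite /reading_word rev_cons flatten_rcons. Qed.

Lemma reading_word_cat T1 T2 :
  reading_word (T1 ++ T2) = reading_word T2 ++ reading_word T1.
Proof. by rewrite /reading_word rev_cat flatten_cat. Qed.

Lemma knuth_insert T x : rows_sorted T ->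
  knuth s (rcons (reading_word T) x) (reading_word (insert s T x)).
Proof.
elim: T x => [|u T IH] x; first by rewrite /reading_word /=; constructor.
rewrite insert_cons /= => /andP[su sT].
rewrite !reading_word_cons rcons_cat.
apply: knuth_trans (knuth_catl _ (knuth_bump x su)) _; rewrite catA; apply: knuth_catr.
case: bumpP => [_|p y q _ _ _] /=; first by rewrite cats0; constructor.
by rewrite cats1; apply: IH.
Qed.

Lemma knuth_foldl_insert T w : rows_sorted T ->
  knuth s (reading_word T ++ w) (reading_word (foldl (insert s) T w)).
Proof.
elim: w T => [|x w IH] T sT /=; first by rewrite cats0; constructor.
apply: knuth_trans (IH _ (insert_rows_sorted x sT)).
by rewrite -cat_rcons; apply: knuth_catr; apply: knuth_insert.
Qed.

Definition product P Q := foldl (insert s) P (reading_word Q).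

Lemma product_foldl P T w : rows_sorted P -> rows_sorted T ->
  product P (foldl (insert s) T w) = foldl (insert s) P (reading_word T ++ w).
Proof.
by move=> sP sT; apply: foldl_insert_knuth => //; apply/knuth_sym/knuth_foldl_insert.
Qed.

Lemma productA P Q T : rows_sorted P -> rows_sorted Q ->
  product P (product Q T) = product (product P Q) T.
Proof. by move=> sP sQ; rewrite product_foldl // foldl_cat. Qed.

Lemma product_perm P Q : rows_sorted P ->
  perm_eq (flatten (product P Q)) (flatten P ++ flatten Q).
Proof.
have rw T : perm_eq (reading_word T) (flatten T).
  by apply: perm_flatten; rewrite perm_rev.
move=> sP; have /knuth_perm := knuth_foldl_insert (reading_word Q) sP.
rewrite perm_sym => H; apply: perm_trans (perm_cat (rw P) (rw Q)).
by apply: perm_trans H; rewrite perm_sym.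
Qed.

End Product.

(** * Tableaux *)

Definition strictly_above s (u v : seq int) : bool :=
  (size v <= size u) && all (fun p => cmp s p.1 p.2) (zip u v).

(** Trailing empty rows are allowed; they arise when columns are cut off. *)
Definition padded_tableau s (T : filling) := rows_sorted s T && sorted (strictly_above s) T.

Definition tableau s (T : filling) := ([::] \notin T) && padded_tableau s T.

Section Tableaux.

Variable s : bool.
Implicit Types (u v w p q : seq int) (x y z : int) (T P Q : filling).

Notation le_all u x := (all (fun y => ~~ cmp s x y) u).
Local Notation above := (strictly_above s).

Lemma aboveP u v :
  reflect (size v <= size u /\
           forall j, j < size v -> cmp s (nth 0%R u j) (nth 0%R v j)) (above u v).
Proof.
rewrite /strictly_above; apply: (iffP andP) => -[uv H]; split=> //.
  move=> j jv; have /(all_nthP (0%R, 0%R))/(_ j) := H.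
  have jz : j < size (zip u v) by rewrite size_zip; lia.
  by rewrite nth_zip_cond jz; apply.
apply/(all_nthP (0%R, 0%R)) => j jz; rewrite nth_zip_cond jz; apply: H.
rewrite size_zip leq_min in jz; by case/andP: jz.
Qed.

Lemma above_cons x u y v : above (x :: u) (y :: v) = cmp s x y && above u v.
Proof. by rewrite /strictly_above /= ltnS andbCA. Qed.

Lemma above_nil u : above u [::].
Proof. by rewrite /strictly_above; case: u. Qed.

Lemma above_trans : transitive above.
Proof.
move=> v u w /aboveP[uv Huv] /aboveP[vw Hvw]; apply/aboveP; split; first by lia.
by move=> j jw; apply: cmp_trans (Huv j _) (Hvw j jw); lia.
Qed.

Lemma above_drop b u v : above u v -> above (drop b u) (drop b v).
Proof.
elim: b u v => [|b IH] [|x u] [|y v] //=; rewrite ?above_nil ?drop0 //.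
by rewrite above_cons => /andP[_]; apply: IH.
Qed.

Lemma path_above u T : path above u T = above u (head [::] T) && sorted above T.
Proof. by case: T => [|v T] //=; rewrite above_nil. Qed.

Lemma bump1E u x : (bump s u x).1 = set_nth 0%R u (find (cmp s x) u) x.
Proof.
rewrite /bump; case: ltnP => //= ux.
have -> : find (cmp s x) u = size u by have := find_size (cmp s x) u; lia.
by elim: (u) => //= y v ->.
Qed.

Lemma above_bump u v x y : above u v -> (bump s u x).2 = [:: y] ->
  above (bump s u x).1 (bump s v y).1.
Proof.
rewrite !bump1E {1}/bump; set k := find (cmp s x) u; set k' := find (cmp s y) v.
move=> /aboveP[uv Huv]; case: ifP => // ku [def_y].
have xy : cmp s x y by rewrite -def_y; apply: nth_find; rewrite has_find.
(* The bumping path moves weakly to the left: the entry of [v] below the bumped letter [y], if there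
   is one, can be bumped by [y]. *)
have k'k : k' <= k.
  rewrite leqNgt; apply/negP => kk'; have := before_find 0%R kk'.
  by rewrite -{1}def_y Huv //; apply: leq_trans kk' (find_size _ _).
apply/aboveP; rewrite !size_set_nth; split; first by lia.
move=> j jv; rewrite !nth_set_nth /=.
case: (j =P k') => [->|jk'].
  case: eqP => // k'k0; have /(before_find 0%R)/negbT k'x : k' < k by lia.
  exact: cmp_Ntrans k'x xy.
have {}jv : j < size v by have := find_size (cmp s y) v; rewrite -/k'; lia.
case: eqP => [def_j|_]; last exact: Huv.
by apply: cmp_trans xy _; rewrite -def_y -def_j; apply: Huv.
Qed.

Lemma insert_neq0 T x : [::] \notin T -> [::] \notin insert s T x.
Proof.
elim: T x => [|u T IH] x; rewrite ?insert_cons !inE // !negb_or => /andP[u0 T0].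
case: bumpP => [_|p y q _ _ _] /=; first by rewrite T0; case: (u).
by rewrite IH // andbT; case: p.
Qed.

Lemma head_insert T x : head [::] (insert s T x) = (bump s (head [::] T) x).1.
Proof. by case: T => [|u T] //; rewrite insert_cons. Qed.

Lemma insert_sorted T x : sorted above T -> sorted above (insert s T x).
Proof.
elim: T x => [|u T IH] x //; rewrite insert_cons /= !path_above => /andP[uT sT].
have := @above_bump u (head [::] T) x; case: bumpP => [_ _|p y q _ _ _ /(_ y uT erefl) /= H] /=.
  rewrite sT andbT; apply/aboveP; have /aboveP[uT' H] := uT.
  rewrite size_rcons; split=> [|j jT]; first by lia.
  by rewrite nth_rcons (leq_trans jT uT') H.
by rewrite head_insert H IH.
Qed.

Lemma tableau_insert T x : tableau s T -> tableau s (insert s T x).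
Proof. by move=> /and3P[T0 rT sT];
  rewrite /tableau /padded_tableau insert_neq0 ?insert_sorted ?insert_rows_sorted. Qed.

Lemma tableau_foldl_insert T w : tableau s T -> tableau s (foldl (insert s) T w).
Proof. by elim: w T => //= x w IH T /(tableau_insert x)/IH. Qed.

Lemma tableau_rows_sorted T : tableau s T -> rows_sorted s T.
Proof. by case/and3P. Qed.

Lemma tableau_product P Q : tableau s P -> tableau s (product s P Q).
Proof. exact: tableau_foldl_insert. Qed.

Lemma tableau_cons u T : tableau s (u :: T) =
  [&& u != [::], row_sorted s u, above u (head [::] T) & tableau s T].
Proof.
rewrite /tableau /padded_tableau /= inE negb_or path_above eq_sym.
by case: eqP; case: row_sorted; case: strictly_above; case: (_ \in _); case: rows_sorted.
Qed.

(** Each letter of [v] bumps the letter of [u] in its own column, and the letters of [v] beyond the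
    end of [u] are appended. The prefix [p] collects the letters already inserted. *)
Lemma pass_above p u v : row_sorted s (p ++ v) -> above v u ->
  pass s (p ++ u) v = (p ++ v, u).
Proof.
elim: v p u => [|x v IH] p [|y u] //=.
  rewrite cats0 -cat_rcons => sv _; have /bump_out -> : le_all p x.
    by move: sv; rewrite -cats1 !row_sorted_cat allrel1r_cmp => /and3P[_ /and3P[]].
  by rewrite /= -[X in pass _ X](cats0 (rcons p x)) IH ?above_nil.
rewrite above_cons => + /andP[xy vu]; rewrite -!cat_rcons => sv.
have px : le_all p x.
  by move: sv; rewrite -cats1 !row_sorted_cat allrel1r_cmp => /and3P[_ /and3P[]].
by rewrite cat_rcons bump_in //= -cat_rcons IH.
Qed.

Lemma pass_reading_word T : padded_tableau s T ->
  pass s [::] (reading_word T) = (head [::] T, reading_word (behead T)).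
Proof.
elim: T => [|u T IH] // /andP[/= /andP[su sT]]; rewrite path_above => /andP[uT sT'].
rewrite reading_word_cons pass_cat IH ?/padded_tableau ?sT //=.
have := @pass_above [::] (head [::] T) u su uT; rewrite /= => ->.
by case: T {IH uT sT sT'} => // v T; rewrite reading_word_cons.
Qed.

Lemma foldl_insert_reading_word T : tableau s T -> foldl (insert s) [::] (reading_word T) = T.
Proof.
elim: T => // u T IH uT.
rewrite foldl_insert_nil; last first.
  by move: uT; rewrite reading_word_cons tableau_cons; case: (reading_word T); case: (u).
have /andP[_ uT'] := uT.
rewrite pass_reading_word //= IH //.
by move: uT; rewrite tableau_cons => /and4P[].
Qed.

Lemma product0T T : tableau s T -> product s [::] T = T.
Proof. exact: foldl_insert_reading_word. Qed.

Lemma pass_shift p u w : (forall x, x \in w -> le_all p x) ->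
  pass s (p ++ u) w = (p ++ (pass s u w).1, (pass s u w).2).
Proof.
elim: w u => [|x w IH] u //= pw; have px : le_all p x by apply: pw; rewrite mem_head.
have -> : bump s (p ++ u) x = (p ++ (bump s u x).1, (bump s u x).2).
  case: (bumpP s u x) => [ux|u1 y u2 -> u1x xy] /=.
    by rewrite bump_out -?rcons_cat // all_cat px.
  by rewrite catA bump_in ?catA // all_cat px.
by rewrite /= IH // => y yw; apply: pw; rewrite inE yw orbT.
Qed.

Lemma row_sorted_drop b u : row_sorted s u -> row_sorted s (drop b u).
Proof. by rewrite -{1}(cat_take_drop b u) row_sorted_cat => /and3P[]. Qed.

Lemma row_sorted_take b u : row_sorted s u -> row_sorted s (take b u).
Proof. by rewrite -{1}(cat_take_drop b u) row_sorted_cat => /and3P[]. Qed.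

Lemma padded_tableau_drop b T : padded_tableau s T -> padded_tableau s (map (drop b) T).
Proof.
rewrite /padded_tableau /rows_sorted all_map => /andP[sT sT']; apply/andP; split.
  by apply: sub_all sT => u; apply: row_sorted_drop.
by apply: homo_sorted sT' => u v; apply: above_drop.
Qed.

Lemma le_left_columns b v T x y : padded_tableau s (v :: T) ->
  x \in flatten (map (drop b) (v :: T)) -> y \in take b v -> ~~ cmp s x y.
Proof.
move=> /andP[/= /andP[sv _]] vT; rewrite mem_cat => /orP[xv yv|].
  by rewrite -(cat_take_drop b v) in sv; apply: row_sorted_le sv yv xv.
move=> /flatten_mapP[w wT xw] yv.
have /(allP (order_path_min above_trans vT))/(above_drop b)/aboveP[vw H] := wT.
have /(nthP 0%R)[j jw def_x] := xw; move: (H j jw); rewrite def_x => vx.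
have vjy : ~~ cmp s (nth 0%R (drop b v) j) y.
  rewrite -(cat_take_drop b v) in sv; apply: row_sorted_le sv yv _.
  by apply: mem_nth; apply: leq_trans jw vw.
by apply/negP => xy; rewrite (cmp_trans vx xy) in vjy.
Qed.

Lemma mem_reading_word x T : (x \in reading_word T) = (x \in flatten T).
Proof. by apply: perm_mem; apply: perm_flatten; rewrite perm_rev. Qed.

(** No letter of the right part bumps a letter of the left part, so the two parts
    evolve independently. *)
Lemma foldl_insert_columns b T : padded_tableau s T ->
  foldl (insert s) (map (take b) T) (reading_word (map (drop b) T)) = T.
Proof.
elim: T => // v T IH vT; rewrite [map _ _]/= foldl_insert_cons.
rewrite -[take b v]cats0 pass_shift; last first.
  move=> x; rewrite mem_reading_word => xT; apply/allP => y yv.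
  exact: le_left_columns vT xT yv.
rewrite pass_reading_word; last exact: padded_tableau_drop vT.
rewrite /= cat_take_drop IH //.
by move: vT; rewrite /padded_tableau /= path_above => /and3P[/andP[_ ->] _ ->].
Qed.

End Tableaux.

(** * Columns and transposition *)

Definition lcols b (T : filling) := straighten (map (take b) T).
Definition rcols b (T : filling) := straighten (map (drop b) T).

Definition entry (T : filling) i j := onth (nth [::] T i) j.

Definition transpose (T : filling) : filling :=
  mkseq (fun j => pmap (fun u => onth u j) T) (size (head [::] T)).

Section Transpose.

Variable s : bool.
Implicit Types (u v w p q : seq int) (x y z : int) (T P Q W : filling).

Lemma onth_take b u j : onth (take b u) j = if j < b then onth u j else None.
Proof. by elim: u b j => [|x u IH] [|b] [|j] //=; rewrite ?IH // if_same. Qed.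

Lemma onth_drop b u j : onth (drop b u) j = onth u (b + j).
Proof. by elim: b u => [|b IH] [|x u] //=; rewrite ?onth0n ?drop0. Qed.

Lemma entry_nth T i j :
  j < size (nth [::] T i) -> entry T i j = Some (nth 0%R (nth [::] T i) j).
Proof.
rewrite /entry -onthTE -(odflt_onth 0%R); by case: onth.
Qed.

Lemma entry_some T i j x : entry T i j = Some x ->
  j < size (nth [::] T i) /\ nth 0%R (nth [::] T i) j = x.
Proof. by rewrite /entry => H; rewrite -onthTE (onth_nth 0%R _ _ _ H) H. Qed.

Lemma entry_ext T P : [::] \notin T -> [::] \notin P ->
  (forall i j, entry T i j = entry P i j) -> T = P.
Proof.
move=> T0 P0 E; have {}E i : nth [::] T i = nth [::] P i by apply: eq_from_onth; apply: E.
apply: (@eq_from_nth _ [::]) => [|i _]; last exact: E.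
case: (ltngtP (size T) (size P)) => // H.
  by case/negP: P0; rewrite -(nth_default [::] (leqnn (size T))) E mem_nth.
by case/negP: T0; rewrite -(nth_default [::] (leqnn (size P))) -E mem_nth.
Qed.

(** In terms of entries, the conditions on rows and on columns are interchanged by swapping the two
    indices and negating [s]; this is what makes transposition preserve tableaux. *)
Lemma tableauP T : reflect
  [/\ [::] \notin T,
      forall i j y, entry T i j.+1 = Some y ->
        exists2 x, entry T i j = Some x & ~~ cmp s y x &
      forall i j y, entry T i.+1 j = Some y ->
        exists2 x, entry T i j = Some x & cmp s x y] (tableau s T).
Proof.
apply: (iffP and3P) => -[T0 H1 H2]; split=> //.
- move=> i j y /entry_some[ji <-].
  exists (nth 0%R (nth [::] T i) j); first by apply: entry_nth; lia.
  have [iT|Ti] := ltnP i (size T); last by rewrite nth_default in ji.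
  have := allP H1 _ (mem_nth [::] iT); rewrite row_sortedE => /(sortedP 0%R)/(_ _ ji).
  by rewrite cmpN.
- move=> i j y /entry_some[ji <-].
  have [iT|Ti] := ltnP i.+1 (size T); last by rewrite nth_default in ji.
  have /aboveP[L H] := sortedP [::] H2 _ iT.
  exists (nth 0%R (nth [::] T i) j); first by apply: entry_nth; lia.
  exact: H.
- apply/allP => u /(nthP [::])[i iT <-]; rewrite row_sortedE.
  apply/(sortedP 0%R) => j ji; have [x] := H1 i j _ (entry_nth ji).
  by move=> /entry_some[_ <-]; rewrite cmpN.
- apply/(sortedP [::]) => i iT; apply/aboveP; split.
    rewrite leqNgt; apply/negP => L; have [x] := H2 i _ _ (entry_nth L).
    by move=> /entry_some[]; rewrite ltnn.
  by move=> j ji; have [x /entry_some[_ <-]] := H2 i j _ (entry_nth ji).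
Qed.

Lemma tableau_neq0 T : tableau s T -> [::] \notin T.
Proof. by case/and3P. Qed.

Lemma tableau_padded_tableau T : tableau s T -> padded_tableau s T.
Proof. by case/andP. Qed.

Lemma above_take b u v : strictly_above s u v -> strictly_above s (take b u) (take b v).
Proof.
elim: b u v => [|b IH] [|x u] [|y v] //=; rewrite ?above_nil //.
by rewrite !above_cons => /andP[-> /IH].
Qed.

Lemma padded_tableau_take b T : padded_tableau s T -> padded_tableau s (map (take b) T).
Proof.
rewrite /padded_tableau /rows_sorted all_map => /andP[sT sT']; apply/andP; split.
  by apply: sub_all sT => u; apply: row_sorted_take.
by apply: homo_sorted sT' => u v; apply: above_take.
Qed.

Lemma padded_tableau_below u T : padded_tableau s (u :: T) -> {in T, forall v, size v <= size u}.
Proof.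
move=> /andP[_ /= uT] v vT.
by have /aboveP[] := allP (order_path_min (@above_trans s) uT) _ vT.
Qed.

Lemma padded_tableau_behead u T : padded_tableau s (u :: T) -> padded_tableau s T.
Proof. by rewrite /padded_tableau /= path_above => /and3P[/andP[_ ->] _ ->]. Qed.

Lemma straighten_below_nil W : padded_tableau s ([::] :: W) -> straighten W = [::].
Proof.
move=> /padded_tableau_below H; apply/eqP; rewrite -[_ == _]negbK -has_filter.
by apply/hasPn => v /H; rewrite leqn0 negbK.
Qed.

(** In a padded tableau the empty rows are all at the bottom, so discarding them shifts no index. *)
Lemma nth_straighten W i : padded_tableau s W -> nth [::] (straighten W) i = nth [::] W i.
Proof.
elim: W i => [|u W IH] i sW //; rewrite /straighten /=; case: u sW => [|x u] sW /=.
  rewrite -/(straighten W) straighten_below_nil // nth_nil.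
  case: i => //= i; have [iW|Wi] := ltnP i (size W); last by rewrite nth_default.
  by have /= := padded_tableau_below sW (mem_nth [::] iW); case: nth.
by case: i => //= i; apply: IH; apply: padded_tableau_behead sW.
Qed.

Lemma straighten_neq0 W : [::] \notin straighten W.
Proof. by rewrite mem_filter. Qed.

Lemma tableau_straighten W : padded_tableau s W -> tableau s (straighten W).
Proof.
move=> /andP[sW sW']; rewrite /tableau /padded_tableau straighten_neq0.
rewrite sorted_filter ?sW' //=; last exact: above_trans.
by rewrite andbT /rows_sorted all_filter; apply: sub_all sW => u su; apply/implyP.
Qed.

Lemma tableau_lcols b T : tableau s T -> tableau s (lcols b T).
Proof. by move=> /tableau_padded_tableau/(padded_tableau_take b)/tableau_straighten. Qed.

Lemma tableau_rcols b T : tableau s T -> tableau s (rcols b T).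
Proof. by move=> /tableau_padded_tableau/(padded_tableau_drop b)/tableau_straighten. Qed.

Lemma tableau_take a T : tableau s T -> tableau s (take a T).
Proof.
move=> /and3P[T0 sT sT']; apply/and3P; split; last exact: take_sorted.
  by apply: contra T0; apply: mem_take.
by apply/allP => u /mem_take; apply: (allP sT).
Qed.

Lemma tableau_drop a T : tableau s T -> tableau s (drop a T).
Proof.
move=> /and3P[T0 sT sT']; apply/and3P; split; last exact: drop_sorted.
  by apply: contra T0; apply: mem_drop.
by apply/allP => u /mem_drop; apply: (allP sT).
Qed.

Lemma entry_take a T i j : entry (take a T) i j = if i < a then entry T i j else None.
Proof.
rewrite /entry; case: ltnP => ia; first by rewrite nth_take.
by rewrite nth_default ?onth0n // size_take_min; lia.
Qed.

Lemma entry_drop a T i j : entry (drop a T) i j = entry T (a + i) j.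
Proof. by rewrite /entry nth_drop. Qed.

Lemma entry_map (f : seq int -> seq int) T i j : f [::] = [::] ->
  entry (map f T) i j = onth (f (nth [::] T i)) j.
Proof.
move=> f0; rewrite /entry; have [iT|Ti] := ltnP i (size T).
  by rewrite (nth_map [::]).
by rewrite !nth_default ?size_map // f0.
Qed.

Lemma entry_lcols b T i j : tableau s T ->
  entry (lcols b T) i j = if j < b then entry T i j else None.
Proof.
move=> /tableau_padded_tableau/(padded_tableau_take b) H.
by rewrite /entry nth_straighten // -/(entry (map _ T) i j) entry_map // onth_take.
Qed.

Lemma entry_rcols b T i j : tableau s T -> entry (rcols b T) i j = entry T i (b + j).
Proof.
move=> /tableau_padded_tableau/(padded_tableau_drop b) H.
by rewrite /entry nth_straighten // -/(entry (map _ T) i j) entry_map // onth_drop.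
Qed.

Lemma onth_column T i j : padded_tableau s T ->
  onth (pmap (fun u => onth u j) T) i = entry T i j.
Proof.
elim: T i => [|u T IH] i sT; first by rewrite /entry nth_nil !onth0n.
have sT' := padded_tableau_behead sT; rewrite /=; case uj: (onth u j) => [x|] /=.
  by case: i => [|i] /=; rewrite ?IH // /entry /= uj.
have ju : size u <= j by rewrite -onthNE uj.
have T0 k : entry T k j = None.
  have [kT|Tk] := ltnP k (size T); last by rewrite /entry nth_default // onth0n.
  by apply: onth_default; apply: leq_trans ju; apply: padded_tableau_below sT _ (mem_nth _ kT).
by rewrite IH // T0; case: i => [|i]; rewrite /entry //= -/(entry T i j) T0.
Qed.

Lemma entry_transpose T i j : tableau s T -> entry (transpose T) j i = entry T i j.
Proof.
move=> /tableau_padded_tableau sT; rewrite /transpose {1}/entry;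
  have [jT|Tj] := ltnP j (size (head [::] T)).
  by rewrite nth_mkseq // onth_column.
rewrite nth_default ?size_mkseq // onth0n /entry onth_default //.
apply: leq_trans Tj; case: T sT => [|u T] sT /=; first by rewrite nth_nil.
case: i => //= i; have [iT|Ti] := ltnP i (size T); last by rewrite nth_default.
exact: padded_tableau_below sT _ (mem_nth _ iT).
Qed.

Lemma transpose_neq0 T : [::] \notin transpose T.
Proof.
apply/negP => /mapP[j]; rewrite mem_iota /=; case: T => [|u T] //= ju.
by move: ju; rewrite -onthTE; case: onth.
Qed.

End Transpose.

Lemma transpose_tableau s T : tableau s T -> tableau (~~ s) (transpose T).
Proof.
move=> tT; have /tableauP[T0 Hr Hc] := tT; apply/tableauP; split; first exact: transpose_neq0.
- by move=> i j y; rewrite !(entry_transpose _ _ tT) => /Hc[x]; exists x; rewrite // cmpN negbK.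
- by move=> i j y; rewrite !(entry_transpose _ _ tT) => /Hr[x]; exists x; rewrite // cmpN.
Qed.

Lemma transposeK s T : tableau s T -> transpose (transpose T) = T.
Proof.
move=> tT; have tT' := transpose_tableau tT; apply: entry_ext; first exact: transpose_neq0.
  exact: tableau_neq0 tT.
by move=> i j; rewrite (entry_transpose _ _ tT') (entry_transpose _ _ tT).
Qed.

(** This and the next three lemmas translate cuts between columns into cuts between rows of the
    transpose. *)
Lemma transpose_take s T c : tableau s T -> transpose (take c (transpose T)) = lcols c T.
Proof.
move=> tT; have tT' := tableau_take c (transpose_tableau tT); apply: entry_ext;
  first exact: transpose_neq0.
  exact: straighten_neq0.
by move=> i j; rewrite (entry_transpose _ _ tT') entry_take (entry_transpose _ _ tT)
  (entry_lcols _ _ _ tT).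
Qed.

Lemma transpose_drop s T c : tableau s T -> transpose (drop c (transpose T)) = rcols c T.
Proof.
move=> tT; have tT' := tableau_drop c (transpose_tableau tT); apply: entry_ext;
  first exact: transpose_neq0.
  exact: straighten_neq0.
by move=> i j; rewrite (entry_transpose _ _ tT') entry_drop (entry_transpose _ _ tT)
  (entry_rcols _ _ _ tT).
Qed.

Lemma transpose_lcols s T c : tableau s T -> transpose (lcols c T) = take c (transpose T).
Proof. by move=> tT; rewrite -(transpose_take c tT) (transposeK (tableau_take c
  (transpose_tableau tT))). Qed.

Lemma transpose_rcols s T c : tableau s T -> transpose (rcols c T) = drop c (transpose T).
Proof. by move=> tT; rewrite -(transpose_drop c tT) (transposeK (tableau_drop c
  (transpose_tableau tT))). Qed.

Lemma flatten_straighten W : flatten (straighten W) = flatten W.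
Proof. by elim: W => //= -[|x u] W IH //=; rewrite IH. Qed.

Lemma reading_word_straighten W : reading_word (straighten W) = reading_word W.
Proof. by rewrite /reading_word /straighten -filter_rev -/(straighten _) flatten_straighten. Qed.

Lemma knuth_rev s w1 w2 : knuth s w1 w2 -> knuth (~~ s) (rev w1) (rev w2).
Proof.
elim=> {w1 w2} [w|w1 w2 _|w2 w1 w3 _ H1 _ H2|p q x y z xy yz|p q x y z xy yz].
- exact: knuth_refl.
- exact: knuth_sym.
- exact: knuth_trans H1 H2.
- rewrite !rev_cat -!catA; apply: (@knuth_xzy _ (rev q) (rev p)).
    by rewrite cmpN negbK.
  by rewrite cmpN.
- rewrite !rev_cat -!catA; apply: (@knuth_yzx _ (rev q) (rev p)).
    by rewrite cmpN.
  by rewrite cmpN negbK.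
Qed.

Lemma knuth_columns s b T : tableau s T ->
  knuth s (reading_word (lcols b T) ++ reading_word (rcols b T)) (reading_word T).
Proof.
move=> /tableau_padded_tableau sT; rewrite !reading_word_straighten.
have /andP[rT _] := padded_tableau_take b sT.
by have := knuth_foldl_insert (reading_word (map (drop b) T)) rT; rewrite foldl_insert_columns.
Qed.

Lemma reading_word_column s T : tableau s T ->
  reading_word (lcols 1 T) = rev (reading_word (transpose (lcols 1 T))).
Proof.
move=> tT; rewrite (transpose_lcols _ tT) /transpose; have := tableau_neq0 tT.
case: T {tT} => [|u T] //; rewrite reading_word_straighten.
case: u => [|x u] //= T0; rewrite !take0 /reading_word /= cats0.
rewrite rev_cons flatten_rcons rev_cons -cats1; congr (_ ++ _).
elim: T T0 => [|[|y v] T IH] //= T0; rewrite take0 !rev_cons flatten_rcons IH ?cats1 //.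
Qed.

(** The right-hand side is the column word: columns from left to right, each read upwards. The first
    column is split off by [knuth_columns], and the induction is on the number of columns. *)
Lemma knuth_transpose s T : tableau s T ->
  knuth s (reading_word T) (rev (reading_word (transpose T))).
Proof.
have [n] := ubnP (size (transpose T)); elim: n T => // n IH T Tn tT.
case: T Tn tT => [|u T] Tn tT; first exact: knuth_refl.
rewrite -(cat_take_drop 1 (transpose (u :: T))) -(transpose_lcols 1 tT) -(transpose_rcols 1 tT).
rewrite reading_word_cat rev_cat -(reading_word_column tT).
apply: knuth_trans (knuth_sym (knuth_columns 1 tT)) _; apply: knuth_catl; apply: IH.
  have : 0 < size (transpose (u :: T)) by rewrite size_mkseq; have := tableau_neq0 tT; case: (u).
  by rewrite (transpose_rcols 1 tT) size_drop; lia.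
exact: tableau_rcols.
Qed.

(** Both sides are insertion tableaux of Knuth equivalent words, since the
    column word of a tableau is Knuth equivalent to its row word. *)
Lemma transpose_product s P Q : tableau s P -> tableau s Q ->
  transpose (product s P Q) = product (~~ s) (transpose Q) (transpose P).
Proof.
move=> tP tQ; have tV := tableau_product Q tP; have tV' := transpose_tableau tV.
rewrite -[LHS](foldl_insert_reading_word tV') [RHS]/product.
rewrite -[transpose Q in RHS](foldl_insert_reading_word (transpose_tableau tQ)) -foldl_cat.
apply: foldl_insert_knuth => //.
rewrite -[reading_word (transpose (product _ _ _))]revK -[_ ++ _]revK; apply: knuth_rev.
apply: knuth_trans (knuth_sym (knuth_transpose tV)) _.
apply: knuth_trans (knuth_sym (knuth_foldl_insert _ (tableau_rows_sorted tP))) _.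
rewrite rev_cat; apply: knuth_trans (knuth_catr _ (knuth_transpose tP)) (knuth_catl _
  (knuth_transpose tQ)).
Qed.

(** * Cutting a product by rows and by columns *)

(** Rows are concatenated from the top.  This is the product [T . P] when the
    letters of [T] are too small to be bumped by those of [P]. *)
Fixpoint juxt (T P : filling) : filling :=
  match T, P with
  | u :: T', v :: P' => (u ++ v) :: juxt T' P'
  | [::], _ => P
  | _, [::] => T
  end.

Section Cuts.

Variable s : bool.
Implicit Types (u v w p q : seq int) (x y z : int) (T P Q A X W : filling).

Lemma product_drop_take a T : tableau s T -> product s (drop a T) (take a T) = T.
Proof.
move=> tT; rewrite /product -{1}(foldl_insert_reading_word (tableau_drop a tT)) -foldl_cat.
by rewrite -reading_word_cat cat_take_drop foldl_insert_reading_word.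
Qed.

Lemma take_foldl_insert a P w :
  take a (foldl (insert s) P w) = take a (foldl (insert s) (take a P) w).
Proof.
elim: P a w => [|u P IH] [|a] w; rewrite ?take0 //=.
by rewrite !foldl_insert_cons /= IH.
Qed.

Lemma take_product a P Q : take a (product s P Q) = take a (product s (take a P) Q).
Proof. exact: take_foldl_insert. Qed.

Lemma juxt0 T : juxt T [::] = T.
Proof. by case: T. Qed.

Lemma foldl_insert_juxt T P w :
  (forall x y, x \in w ++ flatten P -> y \in flatten T -> ~~ cmp s x y) ->
  foldl (insert s) (juxt T P) w = juxt T (foldl (insert s) P w).
Proof.
elim: T P w => [|u T IH] P w H //.
(* If [P] is empty and [w] is not, [P] may be replaced by the filling with one empty row, since the
   first letter of [w] creates that row anyway. *)
wlog [v [P' def_P]] : P H / exists v P', P = v :: P'.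
  move=> W; case: P H => [|v P'] H; last by apply: W => //; exists v, P'.
  have [->|/eqP w0] := eqVneq w [::]; first by rewrite juxt0.
  rewrite foldl_insert_nil // -foldl_insert_cons -W //; last by exists [::], [::].
  by rewrite /= cats0 juxt0.
rewrite def_P /= !foldl_insert_cons pass_shift; last first.
  by move=> x xw; apply/allP => y yu; apply: H; rewrite mem_cat ?xw ?yu.
rewrite /= IH // => x y xw yT; apply: H; last by rewrite mem_cat yT orbT.
move: xw; rewrite def_P /= !mem_cat => /orP[xw|->]; last by rewrite !orbT.
have /perm_mem/(_ x) := pass_perm s v w; rewrite !mem_cat xw orbT.
by case: (x \in v); case: (x \in w).
Qed.

Lemma product_juxt T P : tableau s P ->
  (forall x y, x \in flatten P -> y \in flatten T -> ~~ cmp s x y) ->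
  product s T P = juxt T P.
Proof.
move=> tP H; rewrite -{2}(foldl_insert_reading_word tP) -foldl_insert_juxt ?juxt0 //.
by move=> x y; rewrite cats0 mem_reading_word; apply: H.
Qed.

Lemma mem_flatten_take x a T : x \in flatten (take a T) -> x \in flatten T.
Proof. by rewrite -{2}(cat_take_drop a T) flatten_cat mem_cat => ->. Qed.

Lemma take_juxt T P : take (size T) (juxt T P) = juxt T (take (size T) P).
Proof. by elim: T P => [|u T IH] [|v P] //=; rewrite ?take0 ?take_size ?IH. Qed.

Lemma drop_juxt T P : drop (size T) (juxt T P) = drop (size T) P.
Proof. by elim: T P => [|u T IH] [|v P] //=; rewrite drop_size. Qed.

(** The product is the juxtaposition of [T] and [P], so below row [a] it agrees with [P], and above
    it is the juxtaposition of [T] and [take a P]. The height is only prescribed for nonempty [T]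
    because an empty rectangle may have [a > 0] rows of length 0. *)
Lemma product_splitl a T P : tableau s T -> tableau s P -> (T <> [::] -> size T = a) ->
  (forall x y, x \in flatten P -> y \in flatten T -> ~~ cmp s x y) ->
  product s T P = product s (drop a P) (product s T (take a P)).
Proof.
move=> tT tP Ta H; case: (T =P [::]) Ta => [-> _|T0 /(_ T0) Ta].
  by rewrite !product0T ?product_drop_take //; apply: tableau_take.
rewrite -{1}(product_drop_take a (tableau_product P tT)) (product_juxt tP H) -Ta take_juxt
  drop_juxt.
rewrite (@product_juxt T); [by [] | exact: tableau_take |].
by move=> x y /mem_flatten_take; apply: H.
Qed.

(** This count never decreases under insertion. If it is the same before and after a sequence of
    insertions, then no step has changed it. *)
Definition lsize b T := size (flatten (map (take b) T)).

Lemma lsize_cons b u T : lsize b (u :: T) = minn b (size u) + lsize b T.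
Proof. by rewrite /lsize /= size_cat size_take_min. Qed.

Lemma leq_lsize_insert b T x : lsize b T <= lsize b (insert s T x).
Proof.
elim: T x => [|u T IH] x //; rewrite insert_cons !lsize_cons.
case: bumpP => [_|p y q -> _ _] /=; first by rewrite size_rcons; lia.
by have := IH y; rewrite !size_cat /=; lia.
Qed.

Lemma leq_lsize_foldl_insert b T w : lsize b T <= lsize b (foldl (insert s) T w).
Proof. by elim: w T => //= x w IH T; apply: leq_trans (leq_lsize_insert b T x) (IH _). Qed.

(** A bumping path that ends to the right of column [b] lies there entirely, since
    bumping paths move weakly to the left. *)
Lemma insert_right b T x : 0 < b -> padded_tableau s T -> lsize b (insert s T x) = lsize b T ->
  [/\ b <= find (cmp s x) (head [::] T),
      map (take b) (insert s T x) = map (take b) T &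
      map (drop b) (insert s T x) = insert s (map (drop b) T) x].
Proof.
move=> b0; elim: T x => [|u T IH] x sT.
  by rewrite /= lsize_cons /=; lia.
have sT' := padded_tableau_behead sT;
  rewrite insert_cons map_cons insert_cons !lsize_cons [head _ _]/=.
have drop_catl p q : b <= size p -> drop b (p ++ q) = drop b p ++ q.
  by rewrite drop_cat leq_eqVlt => /predU1P[->|->] //; rewrite ltnn subnn drop0 drop_size.
case: (bumpP s u x) => [ux|p y q def_u px xy] /=.
  rewrite size_rcons => E; have bu : b <= size u by lia.
  rewrite hasNfind -?all_predC // -!cats1 takel_cat // drop_catl //.
  by rewrite bump_out ?cats1 //; apply/allP => t /mem_drop /(allP ux).
rewrite def_u !size_cat /= => E; have {}E : lsize b (insert s T y) = lsize b T by lia.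
have [bT take_T drop_T] := IH y sT' E.
have bp : b <= size p.
  rewrite leqNgt; apply/negP => pb.
  have := before_find 0%R (leq_trans pb bT).
  move: sT; rewrite /padded_tableau /= path_above => /and3P[_ /aboveP[_ H] _].
  have := H (size p); rewrite def_u nth_cat ltnn subnn /= => ->//.
  exact: leq_trans (leq_trans pb bT) (find_size _ _).
split.
- rewrite find_cat ifN; first by rewrite (leq_trans bp) ?leq_addr.
  by rewrite -all_predC.
- by rewrite take_T !takel_cat.
- rewrite drop_T !drop_catl // bump_in //.
  by apply/allP => t /mem_drop /(allP px).
Qed.

Lemma foldl_insert_right b T w :
  0 < b -> tableau s T -> lsize b (foldl (insert s) T w) = lsize b T ->
  map (take b) (foldl (insert s) T w) = map (take b) T /\
  map (drop b) (foldl (insert s) T w) = foldl (insert s) (map (drop b) T) w.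
Proof.
move=> b0; elim: w T => [|x w IH] T tT //= E.
have L1 := leq_lsize_insert b T x; have L2 := leq_lsize_foldl_insert b (insert s T x) w.
have E1 : lsize b (insert s T x) = lsize b T by lia.
have [_ <- <-] := insert_right b0 (tableau_padded_tableau tT) E1.
by apply: IH; [apply: tableau_insert | lia].
Qed.

Lemma straighten_cons u W : straighten (u :: W) = (if nilp u then id else cons u) (straighten W).
Proof. by rewrite /straighten /=; case: nilp. Qed.

(** Filling the first empty row of a padded tableau amounts to creating a new row at the bottom of
    the straightened one. *)
Lemma straighten_insert W x : padded_tableau s W ->
  straighten (insert s W x) = insert s (straighten W) x.
Proof.
elim: W x => [|u W IH] x sW //; have sW' := padded_tableau_behead sW.
case: u sW => [|y u] sW.
  by rewrite insert_cons !straighten_cons /= (straighten_below_nil sW).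
have -> : straighten ((y :: u) :: W) = (y :: u) :: straighten W by [].
rewrite !insert_cons straighten_cons.
by case: bumpP => [_|p z q _ _ _] /=; rewrite ?IH //; case: p.
Qed.

Lemma straighten_foldl_insert W w : padded_tableau s W ->
  straighten (foldl (insert s) W w) = foldl (insert s) (straighten W) w.
Proof.
elim: w W => //= x w IH W sW; rewrite IH ?straighten_insert //.
by move: sW => /andP[rW sW]; rewrite /padded_tableau insert_sorted ?insert_rows_sorted.
Qed.

Lemma lsize_lcols b T : size (flatten (lcols b T)) = lsize b T.
Proof. by rewrite /lcols flatten_straighten. Qed.

Lemma straighten_id T : [::] \notin T -> straighten T = T.
Proof.
by move=> T0; apply/all_filterP/allP => u uT; apply: contra T0 => /nilP <-.
Qed.

Lemma lcols0 T : lcols 0 T = [::].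
Proof. by elim: T => //= u T; rewrite /lcols /straighten /= take0. Qed.

Lemma rcols0 T : [::] \notin T -> rcols 0 T = T.
Proof.
move=> T0; rewrite /rcols (eq_map (g := id)) ?map_id ?straighten_id // => u.
exact: drop0.
Qed.

Lemma product_right b A X : tableau s A -> lsize b (product s A X) = lsize b A ->
  lcols b (product s A X) = lcols b A /\ rcols b (product s A X) = product s (rcols b A) X.
Proof.
(* For [b = 0] the identities before straightening may fail, since a newly created row leaves an
   empty row in [map (take 0)]. *)
move=> tA; case: b => [_|b E].
  by rewrite !lcols0 !rcols0 ?(tableau_neq0 tA) // (tableau_neq0 (tableau_product X tA)).
have [E1 E2] := foldl_insert_right (ltn0Sn b) tA E.
rewrite /lcols /rcols E1 E2 straighten_foldl_insert //.
exact: padded_tableau_drop (tableau_padded_tableau tA).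
Qed.

End Cuts.

(** * Dual cuts, obtained by transposition *)

Section DualCuts.

Variable s : bool.
Implicit Types (T P Q A X W : filling).

Lemma product_lcols_rcols b T : tableau s T -> product s (lcols b T) (rcols b T) = T.
Proof.
move=> tT; have [tl tr] := (tableau_lcols b tT, tableau_rcols b tT).
apply: etrans (transposeK tT); rewrite -[LHS](transposeK (tableau_product _ tl)); congr transpose.
by rewrite transpose_product // (transpose_lcols _ tT) (transpose_rcols _ tT) product_drop_take
  //; apply: transpose_tableau.
Qed.

Lemma lcols_product b P Q : tableau s P -> tableau s Q ->
  lcols b (product s P Q) = lcols b (product s P (lcols b Q)).
Proof.
move=> tP tQ; rewrite -(transpose_take b (tableau_product Q tP)) -(transpose_take b
  (tableau_product (lcols b Q) tP)).
by rewrite !(transpose_product, tableau_lcols) // (transpose_lcols _ tQ) take_product.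
Qed.

(** This is [product_splitl] for the transposes: the factors change sides, the height of [T] becomes
    its width, and the negated comparison for [~~ s] becomes a comparison for [s]. *)
Lemma product_splitr b T Q : tableau s T -> tableau s Q -> (T <> [::] -> size (head [::] T) = b) ->
  (forall x y, x \in flatten Q -> y \in flatten T -> cmp s y x) ->
  product s Q T = product s (product s (lcols b Q) T) (rcols b Q).
Proof.
move=> tT tQ Tb H; have tl := tableau_lcols b tQ; have tQT := tableau_product T tl.
rewrite -[LHS](transposeK (tableau_product T tQ)) -[RHS](transposeK (tableau_product _ tQT));
  congr transpose.
rewrite !transpose_product //; last exact: tableau_rcols.
rewrite (transpose_lcols _ tQ) (transpose_rcols _ tQ); apply: product_splitl;
  try exact: transpose_tableau.
  by case: (T) Tb => // u T' Tb _; rewrite size_mkseq Tb.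
have mem_transpose U x : tableau s U -> (x \in flatten (transpose U)) = (x \in flatten U).
  by move=> tU; rewrite -(mem_reading_word x U) -(mem_reading_word x (transpose U)) (perm_mem
    (knuth_perm (knuth_transpose tU))) mem_rev.
by move=> x y; rewrite !mem_transpose // cmpN negbK; apply: H.
Qed.

(** The dual of [product_right]: in the transposed product [X] is inserted to the right of column
    [a], hence [X] acts only on the rows of [A] below row [a]. *)
Lemma drop_product a X A : tableau s X -> tableau s A -> take a (product s X A) = take a A ->
  drop a (product s X A) = product s X (drop a A).
Proof.
move=> tX tA E; have tXA := tableau_product A tX; have tA' := transpose_tableau tA.
have /(product_right tA') [_] : lsize a (product (~~ s) (transpose A) (transpose X)) =
  lsize a (transpose A).
  rewrite -!lsize_lcols -transpose_product // -(transpose_take _ (transpose_tableau tXA))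
    -(transpose_take _ tA').
  by rewrite (transposeK tXA) (transposeK tA) E.
rewrite -transpose_product // -(transpose_drop _ (transpose_tableau tXA)) -(transpose_drop _
  tA') (transposeK tXA) (transposeK tA) => /(congr1 transpose).
rewrite (transposeK (tableau_drop a tXA)) => ->.
by rewrite -(transpose_product tX (tableau_drop a tA)) (transposeK (tableau_product _ tX)).
Qed.

Lemma lcols_lcols b c T : c <= b -> tableau s T -> lcols c (lcols b T) = lcols c T.
Proof.
move=> cb tT; have tl := tableau_lcols b tT.
by rewrite -(transpose_take c tl) -(transpose_take c tT) (transpose_lcols _ tT) take_takel.
Qed.

Lemma lcols_take a b T : tableau s T -> lcols b (take a T) = take a (lcols b T).
Proof.
move=> tT; apply: entry_ext; first exact: straighten_neq0.
  by apply: contra (straighten_neq0 (map (take b) T)); apply: mem_take.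
move=> i j; rewrite (entry_lcols _ _ _ (tableau_take a tT)) !entry_take (entry_lcols _ _ _ tT).
by do 2 case: ifP.
Qed.

Lemma rcols_take a b T : tableau s T -> rcols b (take a T) = take a (rcols b T).
Proof.
move=> tT; apply: entry_ext; first exact: straighten_neq0.
  by apply: contra (straighten_neq0 (map (drop b) T)); apply: mem_take.
by move=> i j; rewrite (entry_rcols _ _ _ (tableau_take a tT)) !entry_take (entry_rcols _ _ _ tT).
Qed.

Lemma lcols_drop a b T : tableau s T -> lcols b (drop a T) = drop a (lcols b T).
Proof.
move=> tT; apply: entry_ext; first exact: straighten_neq0.
  by apply: contra (straighten_neq0 (map (take b) T)); apply: mem_drop.
by move=> i j; rewrite (entry_lcols _ _ _ (tableau_drop a tT)) !entry_drop (entry_lcols _ _ _ tT).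
Qed.

Lemma rcols_drop a b T : tableau s T -> rcols b (drop a T) = drop a (rcols b T).
Proof.
move=> tT; apply: entry_ext; first exact: straighten_neq0.
  by apply: contra (straighten_neq0 (map (drop b) T)); apply: mem_drop.
by move=> i j; rewrite (entry_rcols _ _ _ (tableau_drop a tT)) !entry_drop (entry_rcols _ _ _ tT).
Qed.

End DualCuts.

(** * Products with a rectangle *)

Section TableauProduct.

Implicit Types (T P Q A X C W : filling).

Lemma is_tableauE T : is_tableau T = tableau true T.
Proof. by rewrite /is_tableau /tableau /padded_tableau /rows_sorted (eq_all (row_sortedE true)).
  Qed.

Lemma is_tableau_tprod P Q : is_tableau P -> is_tableau (P ** Q).
Proof. by rewrite !is_tableauE; apply: tableau_product. Qed.

Lemma tprodA P Q A : is_tableau P -> is_tableau Q -> P ** (Q ** A) = P ** Q ** A.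
Proof. by rewrite !is_tableauE => /tableau_rows_sorted tP /tableau_rows_sorted tQ;
  apply: (productA A tP tQ). Qed.

Lemma tprod0f P : is_tableau P -> [::] ** P = P.
Proof. by rewrite is_tableauE; apply: product0T. Qed.

Lemma is_tableau_lcols b T : is_tableau T -> is_tableau (lcols b T).
Proof. by rewrite !is_tableauE; apply: tableau_lcols. Qed.

Lemma is_tableau_rcols b T : is_tableau T -> is_tableau (rcols b T).
Proof. by rewrite !is_tableauE; apply: tableau_rcols. Qed.

Lemma is_tableau_take a T : is_tableau T -> is_tableau (take a T).
Proof. by rewrite !is_tableauE; apply: tableau_take. Qed.

Lemma is_tableau_drop a T : is_tableau T -> is_tableau (drop a T).
Proof. by rewrite !is_tableauE; apply: tableau_drop. Qed.

Lemma mem_tprod P Q x : is_tableau P ->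
  (x \in flatten (P ** Q)) = (x \in flatten P) || (x \in flatten Q).
Proof.
rewrite is_tableauE => /tableau_rows_sorted sP.
by rewrite -mem_cat (perm_mem (product_perm Q sP)).
Qed.

Lemma flatten_eq0 T : is_tableau T -> flatten T = [::] -> T = [::].
Proof. by rewrite is_tableauE => /tableau_neq0; case: T => [|[|x u] T]. Qed.

Lemma tprod_eq0 P Q : is_tableau P -> is_tableau Q -> P ** Q = [::] -> P = [::] /\ Q = [::].
Proof.
move=> tP tQ PQ; have := tP; rewrite is_tableauE => /tableau_rows_sorted sP.
have := product_perm Q sP; rewrite -[product true P Q]/(P ** Q) PQ perm_sym => /perm_nilP.
move=> /(congr1 size); rewrite size_cat => /eqP; rewrite addn_eq0 => /andP[p0 q0].
by split; apply: flatten_eq0 => //; apply/nilP.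
Qed.

Definition entries_lt T P := forall x y, x \in flatten P -> y \in flatten T -> (y < x)%R.

Lemma rect_shape a b T : shape T = rect a b -> T <> [::] ->
  [/\ size T = a, 0 < b & all (fun u => size u == b) T].
Proof.
move=> shT T0; have b0 : 0 < b.
  rewrite lt0n; apply/eqP => b0; apply: T0; apply/nilP.
  rewrite /nilp -(size_map size) -/(shape T) shT b0 /rect.
  by elim: (a) => //= k ->.
have E : rect a b = nseq a b by rewrite /rect; elim: (a) => //= k ->; rewrite b0.
split=> //; first by rewrite -(size_map size) -/(shape T) shT E size_nseq.
apply/allP => u uT; have : size u \in shape T by apply: map_f.
by rewrite shT E mem_nseq => /andP[].
Qed.

Lemma head_rect_shape a b T : shape T = rect a b -> T <> [::] -> size (head [::] T) = b.
Proof. by move=> sh T0; have [_ _] := rect_shape sh T0;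
  case: T T0 {sh} => //= u T _ /andP[/eqP]. Qed.

(** * The canonical factorization with respect to a rectangle *)

Section CanonicalFactorization.

Variables (a b : nat) (T : filling).
Hypotheses (tT : is_tableau T) (shT : shape T = rect a b).

Lemma tprod_move_right Q : is_tableau Q -> entries_lt T Q -> Q ** T = lcols b Q ** T ** rcols b Q.
Proof.
move=> tQ TQ; apply: (@product_splitr true); rewrite -?is_tableauE //.
exact: head_rect_shape shT.
Qed.

Lemma tprod_move_left P : is_tableau P -> entries_lt T P ->
  T ** P = drop a P ** (T ** take a P).
Proof.
move=> tP TP; apply: (@product_splitl true); rewrite -?is_tableauE //.
  by move=> T0; have [] := rect_shape shT T0.
by move=> x y /TP{}TP /TP; rewrite /cmp -leNgt => /ltW.
Qed.

Let entries_lt_cmp P : entries_lt T P ->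
  forall x y, x \in flatten P -> y \in flatten T -> ~~ cmp true x y.
Proof. by move=> TP x y /TP{}TP /TP; rewrite /cmp -leNgt => /ltW. Qed.

Lemma take_tprod_rect P : is_tableau P -> entries_lt T P -> take a (T ** P) = T ** take a P.
Proof.
move=> tP TP; have tP' := is_tableau_take a tP; have [->|/eqP T0] := eqVneq T [::].
  by rewrite !tprod0f.
have [Ta _ _] := rect_shape shT T0.
rewrite -[T ** P]/(product true T P) -[T ** take a P]/(product true T (take a P)).
rewrite !product_juxt -?is_tableauE //; [by rewrite -Ta take_juxt | | exact: entries_lt_cmp].
by move=> x y /mem_flatten_take; apply: entries_lt_cmp.
Qed.

Lemma lcols_rcols_tprod_rect P : is_tableau P -> entries_lt T P -> size P <= a ->
  lcols b (T ** P) = T /\ rcols b (T ** P) = P.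
Proof.
move=> tP TP Pa; have tP0 : [::] \notin P by move: tP; rewrite is_tableauE => /tableau_neq0.
(* An empty [T] means [b = 0], where the cut is at the left border, or [a = 0], where [P] has no
   rows. *)
have [T0|/eqP T0] := eqVneq T [::].
  rewrite T0 tprod0f //; have [b0|b0] := posnP b; first by rewrite b0 lcols0 rcols0.
  suff a0 : a = 0 by move: Pa; rewrite a0; case: (P).
  by move/(congr1 size): shT; rewrite T0 /rect; case: (a) => //= k; rewrite b0.
have [Ta b0 Tb] := rect_shape shT T0.
have tT0 : [::] \notin T by move: tT; rewrite is_tableauE => /tableau_neq0.
rewrite -[T ** P]/(product true T P) product_juxt -?is_tableauE //; last exact: entries_lt_cmp.
rewrite /lcols /rcols -{2}(straighten_id tT0) -{3}(straighten_id tP0).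
rewrite -Ta in Pa; elim: (T) P Pa Tb {tP TP tP0} => [|u V IH] [|v R] // RV /andP[/eqP ub Vb].
  have [E1 E2] := IH [::] isT Vb; rewrite juxt0 in E1 E2.
  by rewrite juxt0 !map_cons !straighten_cons take_oversize ?drop_oversize ?ub //= E1 E2.
have [E1 E2] := IH R RV Vb.
by rewrite [juxt _ _]/= !map_cons !straighten_cons -ub take_size_cat ?drop_size_cat // ub E1 E2.
Qed.

(** Since [Q] has at most [b] columns and larger entries, it fits below [T]; the reading word of the
    stack is that of [Q] followed by that of [T]. *)
Lemma tprod_stack Q : is_tableau Q -> entries_lt T Q -> lcols b Q = Q ->
  is_tableau (T ++ Q) /\ Q ** T = T ++ Q.
Proof.
move=> tQ TQ clQ; have tTQ : is_tableau (T ++ Q).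
  have [->|/eqP T0] := eqVneq T [::]; first by [].
  have [->|/eqP Q0] := eqVneq Q [::]; first by rewrite cats0.
  have [_ b0 Tb] := rect_shape shT T0.
  move: tT tQ; rewrite !is_tableauE => /and3P[nT sT cT] /and3P[nQ sQ cQ].
  apply/and3P; split; first by rewrite mem_cat negb_or nT.
    by rewrite /rows_sorted all_cat; apply/andP.
  have Qb : {in Q, forall v, size v <= b}.
    move=> v; rewrite -clQ mem_filter => /andP[_ /mapP[u _ ->]].
    by rewrite size_take_min geq_minl.
  case: (T) T0 cT Tb TQ => // t V _ /= cV Tb TQ; rewrite cat_path cV /=.
  case: (Q) Q0 Qb cQ TQ => // q R _ Qb /= -> TQ; rewrite andbT.
  have /eqP lb : size (last t V) == b := @allP _ _ (t :: V) Tb _ (mem_last t V).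
  apply/aboveP; rewrite lb; split=> [|j jq]; first by apply: Qb; rewrite mem_head.
  have qb : size q <= b by apply: Qb; rewrite mem_head.
  apply: TQ; first by rewrite /= mem_cat mem_nth.
  apply/flattenP; exists (last t V); first exact: mem_last.
  by rewrite mem_nth // lb; apply: leq_trans jq qb.
split=> //; move: tTQ tQ; rewrite !is_tableauE => tTQ tQ.
rewrite -[LHS]/(product true Q T) /product -{1}(foldl_insert_reading_word tQ) -foldl_cat.
by rewrite -reading_word_cat foldl_insert_reading_word.
Qed.

(** As [Q] has at most [b] columns, [Q ** T] is the stack [T ++ Q], and its first [a] rows, namely
    [T], determine those of the whole product. For the lower rows the product is rewritten as
    [Q ** drop a P] times [T ** take a P]. The second factor already consists of the first [a] rows
    of the result, so [drop_product] leaves the first factor below them. *)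
Lemma canonical_factorization Q P : is_tableau Q -> is_tableau P ->
  entries_lt T Q -> entries_lt T P -> lcols b Q = Q ->
  [/\ take a (Q ** T ** P) = T ** take a P,
      drop a (Q ** T ** P) = Q ** drop a P,
      lcols b (take a (Q ** T ** P)) = T &
      rcols b (take a (Q ** T ** P)) = take a P].
Proof.
move=> tQ tP TQ TP clQ; have tP1 := is_tableau_take a tP; have tP2 := is_tableau_drop a tP.
have [tTQ QT] := tprod_stack tQ TQ clQ.
have takeT : take a (T ++ Q) = T.
  have [T0|/eqP T0] := eqVneq T [::]; last first.
    by have [Ta _ _] := rect_shape shT T0; rewrite take_size_cat.
  have [b0|b0] := posnP b; first by rewrite T0 -clQ b0 lcols0.
  suff -> : a = 0 by rewrite take0.
  by move/(congr1 size): shT; rewrite T0 /rect; case: (a) => //= k; rewrite b0.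
have takeW : take a (Q ** T ** P) = T ** take a P.
  rewrite QT -[_ ** P]/(product true (T ++ Q) P) take_product takeT.
  exact: take_tprod_rect.
have TP1 : entries_lt T (take a P) by move=> x y /mem_flatten_take; apply: TP.
have [] := @lcols_rcols_tprod_rect (take a P) tP1 TP1; first by rewrite size_take_min geq_minl.
rewrite takeW => -> ->; split=> //.
have tQ2 := is_tableau_tprod (drop a P) tQ; have tTP := is_tableau_tprod (take a P) tT.
have EW : Q ** T ** P = Q ** drop a P ** (T ** take a P).
  by rewrite -(tprodA P tQ tT) tprod_move_left // tprodA.
have ta : take a (T ** take a P) = T ** take a P.
  by rewrite take_tprod_rect // take_takel.
rewrite EW -[RHS]/(product true (Q ** drop a P) [::]).
have <- : drop a (T ** take a P) = [::] by rewrite drop_oversize // -ta size_take_min geq_minl.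
apply: (@drop_product true); rewrite -?is_tableauE //.
by rewrite -[LHS]/(take a (_ ** _)) -EW takeW ta.
Qed.

End CanonicalFactorization.

End TableauProduct.

(** * Factor sequences *)

Section FactorSequences.

Implicit Types (A C X : filling) (T : nat -> nat -> filling) (W U P Q : nat -> filling).

Lemma tprod_lcols_rcols b A : is_tableau A -> lcols b A ** rcols b A = A.
Proof. by rewrite is_tableauE; apply: product_lcols_rcols. Qed.

Lemma tprod_drop_take a A : is_tableau A -> drop a A ** take a A = A.
Proof. by rewrite is_tableauE; apply: product_drop_take. Qed.

Lemma lcols_tprod b A X : is_tableau A -> is_tableau X ->
  lcols b (A ** X) = lcols b (A ** lcols b X).
Proof. by rewrite !is_tableauE; apply: lcols_product. Qed.

Lemma lcols_takel b c A : c <= b -> is_tableau A -> lcols c (lcols b A) = lcols c A.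
Proof. by rewrite is_tableauE; apply: lcols_lcols. Qed.

Lemma take_tprod a A X : take a (A ** X) = take a (take a A ** X).
Proof. exact: (take_product true). Qed.

Lemma rcols_tprod b A X : is_tableau A -> lcols b (A ** X) = lcols b A ->
  rcols b (A ** X) = rcols b A ** X.
Proof.
rewrite is_tableauE => tA E; have [] // := @product_right true b A X tA.
by rewrite -!lsize_lcols -[product true A X]/(A ** X) E.
Qed.

Lemma drop_tprod a A X : is_tableau X -> is_tableau A ->
  take a (X ** A) = take a A -> drop a (X ** A) = X ** drop a A.
Proof. by rewrite !is_tableauE; apply: drop_product. Qed.

(** [lsize b] increases weakly along [A], [A ** X], [A ** X ** C]; as its extreme values agree,
    [product_right] applies to the first step. *)
Lemma lcols_tprod_squeeze b A X C : is_tableau A -> is_tableau X ->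
  lcols b (A ** X ** C) = lcols b A -> lcols b (A ** X) = lcols b A.
Proof.
rewrite !is_tableauE => tA tX E; have [] // := @product_right true b A X tA.
have L1 : lsize b A <= lsize b (A ** X) := leq_lsize_foldl_insert true b A _.
have L2 : lsize b (A ** X) <= lsize b (A ** X ** C) := leq_lsize_foldl_insert true b _ _.
have E' : lsize b (A ** X ** C) = lsize b A by rewrite -!lsize_lcols E.
by rewrite -[product true A X]/(A ** X); lia.
Qed.

Lemma entries_lt_lcols b A X : is_tableau X -> entries_lt A X -> entries_lt A (lcols b X).
Proof.
move=> tX AX x y xX; apply: AX.
by rewrite -(tprod_lcols_rcols b tX) mem_tprod ?xX //; apply: is_tableau_lcols.
Qed.

Lemma entries_lt_rcols b A X : is_tableau X -> entries_lt A X -> entries_lt A (rcols b X).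
Proof.
move=> tX AX x y xX; apply: AX.
by rewrite -(tprod_lcols_rcols b tX) mem_tprod ?xX ?orbT //; apply: is_tableau_lcols.
Qed.

Lemma entries_lt_tprod A X C : is_tableau X -> entries_lt A X -> entries_lt A C ->
  entries_lt A (X ** C).
Proof. by move=> tX AX AC x y; rewrite mem_tprod // => /orP[/AX|/AC]; apply. Qed.

(** The sides [a] and [b] of the rectangles are free parameters, so that the bottom rows, with the
    second index shifted, form an array of the same kind and the induction can proceed. *)
Definition decreasing_array m (a b : nat -> nat -> nat) T : Prop :=
  [/\ forall i j, i < j <= m -> is_tableau (T i j) /\ shape (T i j) = rect (a i j) (b i j),
      forall i j, i.+1 < j <= m -> a i j <= a i j.-1 /\ b i j <= b i.+1 j &
      forall i k l j, i <= k -> k < l -> l <= j -> j <= m -> (k, l) <> (i, j) ->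
        entries_lt (T k l) (T i j)].

Lemma decreasing_bottom_rows m a b T : decreasing_array m.+1 a b T ->
  decreasing_array m (fun i j => a i j.+1) (fun i j => b i j.+1) (bottom_rows T).
Proof.
move=> [H1 H2 H3]; split.
- by move=> i j ijm; apply: H1; lia.
- move=> i j ijm; have [] := H2 i j.+1; first by lia.
  by rewrite /= prednK //; lia.
- move=> i k l j ik kl lj jm klij; apply: H3; try lia.
  by move=> [ki lj']; apply: klij; rewrite ki lj'.
Qed.

(** [factor_sequence 0] is [False]; making level 0 vacuous instead lets the
    recursive clause also describe level 1. *)
Definition factor_seq m T W : Prop := if m is 0 then True else factor_sequence m T W.

(** One unfolding of the recursion with [U i] eliminated as [P i ** Q i]. The factors stay visible
    so that they can be changed at a single index. *)
Definition factored m T W Q P : Prop :=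
  [/\ Q 0 = [::], P m = [::],
      forall i, i < m -> is_tableau (Q i) /\ is_tableau (P i.+1),
      forall i, i < m -> W i.+1 = Q i ** T i i.+1 ** P i.+1 &
      factor_seq m.-1 (bottom_rows T) (fun i => P i ** Q i)].

Lemma factor_seq_ext m T U W : (forall i, 1 <= i <= m -> U i = W i) -> factor_seq m T U ->
  factor_seq m T W.
Proof.
case: m => [|[|m]] // E; first by rewrite /= -E.
move=> [V [P [Q [H1 H2 H3 H4 H5]]]]; exists V, P, Q; split=> // i im.
by rewrite -E //; apply: H5.
Qed.

Lemma factor_seq_factored m a b T W : decreasing_array m.+1 a b T ->
  factor_seq m.+1 T W <-> exists Q P, factored m.+1 T W Q P.
Proof.
move=> [H1 _ _]; case: m H1 => [|m] H1.
  have [t01 _] := H1 0 1 isT; split.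
    move=> /= W1; exists (fun _ => [::]), (fun _ => [::]); split=> // -[|i] //= _.
    by rewrite tprod0f.
  move=> [Q [P [Q0 P1 _ /(_ 0 isT) W1 _]]].
  by rewrite /= W1 Q0 P1 tprod0f.
split.
  move=> [U [P [Q [HU HPQ Q0 Pm HW]]]]; exists Q, P; split=> //.
    move=> i im; split.
      case: (i) im => [|j] jm; first by rewrite Q0.
      by have [] := HPQ j.+1; lia.
    have [->|im'] := eqVneq i m.+1; first by rewrite Pm.
    by have [] := HPQ i.+1; lia.
  by apply: (@factor_seq_ext m.+1 _ U) HU => i /HPQ[].
move=> [Q [P [Q0 Pm tQP HW HU]]]; exists (fun i => P i ** Q i), P, Q; split=> //.
move=> i im; split=> //; last by have [] := tQP i; lia.
by have [] := tQP i.-1; [lia | rewrite prednK //; lia].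
Qed.

Lemma factor_seq_content m a b T U i x : decreasing_array m a b T -> factor_seq m T U ->
  1 <= i <= m -> x \in flatten (U i) ->
  exists k l, [/\ k < i, i <= l, l <= m & x \in flatten (T k l)].
Proof.
elim: m a b T U i => [|m IH] a b T U i DT HU im; first by lia.
have [Q [P [Q0 Pm tQP HW HU']]] := (iffLR (factor_seq_factored U DT)) HU.
have DT' := decreasing_bottom_rows DT.
have [tT _ _] := DT; case: i im => // i im; have im' : i < m.+1 by lia.
have [tQ tP] := tQP i im'; have [|tTi _] := tT i i.+1; first by lia.
rewrite HW // !mem_tprod ?is_tableau_tprod // -orbA => /or3P[xQ|xT|xP].
- case: i im im' tQ xQ {tP tTi} => [|i] im im' tQ xQ; first by rewrite Q0 in xQ.
  have [_ tP] := tQP i (ltnW im').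
  have [//||k [l [ki il lm xT]]] := IH _ _ _ _ i.+1 DT' HU'.
    by rewrite mem_tprod // xQ orbT.
  by exists k, l.+1; split=> //; lia.
- by exists i, i.+1; split.
- have [im1|im1] := eqVneq i m; first by rewrite im1 Pm in xP.
  have im2 : 1 <= i.+1 <= m by lia.
  have [|k [l [ki il lm xT]]] := IH _ _ _ _ i.+1 DT' HU' im2; first by rewrite mem_tprod // xP.
  by exists k, l.+1; split=> //; lia.
Qed.

(** Both factors are parts of terms of the bottom sequence. By [factor_seq_content] their entries
    come from tableaux whose index interval strictly contains that of [T i i.+1]. *)
Lemma factored_entries_lt m a b T W Q P i : decreasing_array m.+1 a b T ->
  factored m.+1 T W Q P -> i < m.+1 ->
  entries_lt (T i i.+1) (Q i) /\ entries_lt (T i i.+1) (P i.+1).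
Proof.
move=> DT [Q0 Pm tQP _ HU] im; have DT' := decreasing_bottom_rows DT.
have [_ _ HT] := DT; split=> x y.
  case: i im => [|i] im; first by rewrite Q0.
  move=> xQ; have [_ tP] := tQP i (ltnW im).
  have [||k [l [ki il lm xT]]] := factor_seq_content (i := i.+1) (x := x) DT' HU; first by lia.
    by rewrite mem_tprod // xQ orbT.
  by apply: (HT k i.+1 i.+2 l.+1) xT; try lia; move=> []; lia.
have [->|im1] := eqVneq i m; first by rewrite Pm.
move=> xP; have [_ tP] := tQP i im.
have [||k [l [ki il lm xT]]] := factor_seq_content (i := i.+1) (x := x) DT' HU; first by lia.
  by rewrite mem_tprod // xP.
by apply: (HT k i i.+1 l.+1) xT; try lia; move=> []; lia.
Qed.

(** * Moving a factor to a neighbouring term *)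

Definition update U i A : nat -> filling := fun j => if j == i then A else U j.

Lemma update_eq U i A : update U i A i = A.
Proof. by rewrite /update eqxx. Qed.

Lemma update_neq U i A j : j <> i -> update U i A j = U j.
Proof. by rewrite /update => /eqP/negbTE ->. Qed.

(** For [i = m] the index [i.+1] lies outside the sequence; the last clause says that nothing is
    lost there. The same holds for index 0 in [movable_left]. *)
Definition movable_right m : Prop := forall a b T U i A X,
  decreasing_array m a b T -> factor_seq m T U -> 1 <= i <= m ->
  is_tableau A -> is_tableau X -> U i = A ** X -> lcols (b i.-1 i) (U i) = lcols (b i.-1 i) A ->
  factor_seq m T (update (update U i.+1 (X ** U i.+1)) i A) /\ (i = m -> X = [::]).

Definition movable_left m : Prop := forall a b T U i A X,
  decreasing_array m a b T -> factor_seq m T U -> 1 <= i <= m ->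
  is_tableau A -> is_tableau X -> U i = X ** A -> take (a i.-1 i) (U i) = take (a i.-1 i) A ->
  factor_seq m T (update (update U i.-1 (U i.-1 ** X)) i A) /\ (i = 1 -> X = [::]).

(** In the bottom sequence, [P i ** Q i] loses its right factor [X], and the next term is multiplied
    by [X] on the left: this is a move to the right one level below. For [i = 0] the tableau [Q 0]
    is empty, hence so are [C] and [X]. *)
Lemma factored_move_right m a b T W Q P i C X :
  movable_right m -> decreasing_array m.+1 a b T -> factored m.+1 T W Q P ->
  i < m.+1 -> is_tableau C -> is_tableau X ->
  Q i = C ** X -> lcols (b i i.+1) (Q i) = lcols (b i i.+1) C ->
  W i.+1 = C ** T i i.+1 ** (X ** P i.+1) ->
  factored m.+1 T W (update Q i C) (update P i.+1 (X ** P i.+1)).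
Proof.
move=> mv DT [Q0 Pm tQP HW HU] im tC tX Qi clQ Wi; have DT' := decreasing_bottom_rows DT.
have key : [/\ i = 0 -> C = [::], i = m -> X = [::] &
    factor_seq m (bottom_rows T) (fun j => update P i.+1 (X ** P i.+1) j ** update Q i C j)].
  case: i im Qi clQ Wi => [|i] im Qi clQ Wi.
    have [C0 X0] := tprod_eq0 tC tX (esym (etrans (esym Q0) Qi)).
    split=> //; apply: factor_seq_ext HU => j jm; rewrite (update_neq _ _ (_ : j <> 0));
      last by lia.
    have [->|/eqP j1] := eqVneq j 1; last by rewrite update_neq.
    by rewrite update_eq X0 tprod0f //; have [] := tQP 0.
  have [_ tP] := tQP i (ltnW im); have [tQ tP'] := tQP i.+1 im.
  have [|||||mvU Xm] := mv _ _ _ _ i.+1 (P i.+1 ** C) X DT' HU.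
  - by lia.
  - exact: is_tableau_tprod.
  - exact: tX.
  - by rewrite /= Qi tprodA.
  (* The rectangle of the bottom rows is no wider than the one above it. Its columns in [P ** Q]
     depend only on the columns of [Q] within that width, and these are the columns of [C]. *)
  - have [_ Db _] := DT; have [] := Db i i.+2; first by lia.
    move=> _ /= b12; rewrite -(lcols_takel b12) ?is_tableau_tprod //.
    by rewrite (lcols_tprod _ tP tQ) clQ -lcols_tprod // lcols_takel // is_tableau_tprod.
  split=> //.
  apply: factor_seq_ext mvU => j jm.
  have [->|/eqP ji] := eqVneq j i.+1.
    by rewrite !update_eq update_neq //; lia.
  rewrite update_neq // (update_neq Q) //.
  have [->|/eqP ji'] := eqVneq j i.+2; last by rewrite !update_neq.
  by rewrite !update_eq tprodA.
have [C0 Xm HU'] := key; split=> //.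
- by rewrite /update; case: eqP => // i0; rewrite C0.
- rewrite /update; case: eqP => // - [mi]; rewrite Xm // -mi Pm.
  by [].
- move=> j jm; have [tQ tP] := tQP j jm; rewrite /update eqSS; case: eqP => // _.
  by split=> //; apply: is_tableau_tprod.
- move=> j jm; rewrite /update eqSS; case: eqP => [->|_] //.
  exact: HW.
Qed.

(** Dual to the preceding lemma, with rows instead of columns: [P i.+1 ** Q i.+1] loses its left
    factor [X], which is appended to [P i ** Q i]. For [i = m] the tableau [P m.+1] is empty. *)
Lemma factored_move_left m a b T W Q P i A X :
  movable_left m -> decreasing_array m.+1 a b T -> factored m.+1 T W Q P ->
  i < m.+1 -> is_tableau A -> is_tableau X ->
  P i.+1 = X ** A -> take (a i i.+1) (P i.+1) = take (a i i.+1) A ->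
  W i.+1 = Q i ** X ** T i i.+1 ** A ->
  factored m.+1 T W (update Q i (Q i ** X)) (update P i.+1 A).
Proof.
move=> mv DT [Q0 Pm tQP HW HU] im tA tX Pi takeP Wi; have DT' := decreasing_bottom_rows DT.
have [tQi tPi] := tQP i im.
have key : [/\ i = 0 -> X = [::], i = m -> A = [::] &
    factor_seq m (bottom_rows T) (fun j => update P i.+1 A j ** update Q i (Q i ** X) j)].
  have [im'|/eqP im'] := eqVneq i m.
    rewrite im' in Pi *; have [X0 A0] := tprod_eq0 tX tA (esym (etrans (esym Pm) Pi)).
    split=> //; apply: factor_seq_ext HU => j jm; rewrite (update_neq _ _ (_ : j <> m.+1));
      last by lia.
    by have [->|/eqP j1] := eqVneq j m; [rewrite update_eq X0 | rewrite update_neq].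
  have im1 : i.+1 < m.+1 by lia.
  have [tQ tP'] := tQP i.+1 im1.
  have [|||||mvU X1] := mv _ _ _ _ i.+1 (A ** Q i.+1) X DT' HU.
  - by lia.
  - exact: is_tableau_tprod.
  - exact: tX.
  - by rewrite Pi tprodA.
  - have [_ Db _] := DT; have [] := Db i i.+2; first by lia.
    move=> /= a12 _; rewrite -(take_takel _ a12) take_tprod takeP -take_tprod.
    by rewrite take_takel.
  split=> //; first by move=> i0; apply: X1; rewrite i0.
  apply: factor_seq_ext mvU => j jm.
  have [->|/eqP ji] := eqVneq j i.+1.
    by rewrite !update_eq update_neq //; lia.
  rewrite update_neq // (update_neq P) //.
  have [ji'|/eqP ji'] := eqVneq j i; last by rewrite !update_neq.
  rewrite -ji' !update_eq /= tprodA //; last by rewrite ji'.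
  by have [] := tQP j.-1; [lia | rewrite prednK //; lia].
have [X0 Am HU'] := key; split=> //.
- by rewrite /update; case: eqP => // i0; rewrite -i0 Q0 X0.
- by rewrite /update; case: eqP => // - [mi]; rewrite Am.
- move=> j jm; have [tQ tP] := tQP j jm; rewrite /update eqSS; case: eqP => // _.
  by split=> //; apply: is_tableau_tprod.
- move=> j jm; rewrite /update eqSS; case: eqP => [->|_] //.
  exact: HW.
Qed.

(** The right part of [Q i] is moved into [P i.+1], and then the lower part of the
    new [P i.+1] into [Q i]. *)
Lemma factored_canonical m a b T W Q P i :
  movable_right m -> movable_left m ->
  decreasing_array m.+1 a b T -> factored m.+1 T W Q P -> i < m.+1 ->
  exists Q' P', [/\ factored m.+1 T W Q' P',
    Q' i = drop (a i i.+1) (W i.+1),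
    P' i.+1 = rcols (b i i.+1) (take (a i i.+1) (W i.+1)),
    lcols (b i i.+1) (take (a i i.+1) (W i.+1)) = T i i.+1 &
    forall j, j <> i -> Q' j = Q j /\ P' j.+1 = P j.+1].
Proof.
move=> mvR mvL DT F im; set a0 := a i i.+1; set b0 := b i i.+1.
have [Q0 Pm tQP HW HU] := F; have [tQ tP] := tQP i im.
have [tT shT] : is_tableau (T i i.+1) /\ shape (T i i.+1) = rect a0 b0.
  by have [DT1 _ _] := DT; apply: DT1; lia.
have [TQ TP] := factored_entries_lt DT F im.
have tQ1 := is_tableau_lcols b0 tQ; have tQ2 := is_tableau_rcols b0 tQ.
have TQ1 := entries_lt_lcols (b := b0) tQ TQ; have TQ2 := entries_lt_rcols (b := b0) tQ TQ.
have tP1 := is_tableau_tprod (P i.+1) tQ2; have TP1 := entries_lt_tprod tQ2 TQ2 TP.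
have tTQ := is_tableau_tprod (T i i.+1) tQ1.
have W1 : W i.+1 = lcols b0 (Q i) ** T i i.+1 ** (rcols b0 (Q i) ** P i.+1).
  by rewrite HW // (tprod_move_right tT shT tQ TQ) tprodA.
have clcl : lcols b0 (lcols b0 (Q i)) = lcols b0 (Q i) by apply: lcols_takel.
have F1 := factored_move_right mvR DT F im tQ1 tQ2 (esym (tprod_lcols_rcols b0 tQ)) (esym clcl) W1.
set P1 := rcols b0 (Q i) ** P i.+1 in W1 tP1 TP1 F1.
have tdP := is_tableau_drop a0 tP1; have ttP := is_tableau_take a0 tP1.
have F2 : factored m.+1 T W
    (update (update Q i (lcols b0 (Q i))) i (lcols b0 (Q i) ** drop a0 P1))
    (update (update P i.+1 P1) i.+1 (take a0 P1)).
  have := factored_move_left (A := take a0 P1) (X := drop a0 P1) mvL DT F1 im ttP tdP.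
  rewrite !update_eq; apply; first by rewrite tprod_drop_take.
    by rewrite take_takel.
  rewrite W1 -(tprodA P1 tQ1 tT) (tprod_move_left tT shT tP1 TP1).
  by rewrite !tprodA // is_tableau_tprod.
have [tW dW clW crW] := canonical_factorization tT shT tQ1 tP1 TQ1 TP1 clcl.
rewrite -W1 in tW dW clW crW.
exists (update (update Q i (lcols b0 (Q i))) i (lcols b0 (Q i) ** drop a0 P1)),
       (update (update P i.+1 P1) i.+1 (take a0 P1)).
split=> //; rewrite ?update_eq // => j ji; rewrite !update_neq //; lia.
Qed.

(** The factors are first changed so that [Q i ** T i i.+1] and [P i.+1] are the left and right
    parts of the term, cut after column [b]. By hypothesis the left part is that of [A], so the
    right part is [rcols b A ** X]. Then [X] passes from [P i.+1] to [Q i.+1], which does not change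
    their product. *)
Lemma movable_right_succ m : movable_right m -> movable_left m -> movable_right m.+1.
Proof.
move=> mvR mvL a b T U i A X DT HU im tA tX Ui clU.
have [Q [P F]] := (iffLR (factor_seq_factored U DT)) HU.
case: i im Ui clU => [|i] // im' Ui clU; have im : i < m.+1 by lia.
have {Q P F} [Q [P [F Qi Pi clT _]]] := factored_canonical mvR mvL DT F im.
rewrite [i.+1.-1]/= in clU; set a0 := a i i.+1 in Qi Pi clT; set b0 := b i i.+1 in Pi clT clU.
have tU : is_tableau (U i.+1) by rewrite Ui is_tableau_tprod.
have tdU := is_tableau_drop a0 tU.
have tC := is_tableau_lcols b0 tdU; have tY := is_tableau_rcols b0 tdU.
have CY : Q i = lcols b0 (drop a0 (U i.+1)) ** rcols b0 (drop a0 (U i.+1)).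
  by rewrite Qi tprod_lcols_rcols.
have [_ _ tQP HW _] := F; have [_ tPi] := tQP i im.
have [tT shT] : is_tableau (T i i.+1) /\ shape (T i i.+1) = rect a0 b0.
  by have [DT1 _ _] := DT; apply: DT1; lia.
have [TQ TP] := factored_entries_lt DT F im.
have HWi : U i.+1 = lcols b0 (drop a0 (U i.+1)) ** T i i.+1 **
                    (rcols b0 (drop a0 (U i.+1)) ** P i.+1).
  have tQi : is_tableau (Q i) by rewrite Qi.
  rewrite {1}HW // (tprod_move_right tT shT tQi TQ) Qi.
  by rewrite tprodA // is_tableau_tprod.
(* Starting from the canonical factorization, the columns beyond [b] of the lower rows are moved
   into [P i.+1]. Lower and upper rows of each column part then recombine by [tprod_drop_take]. *)
have [Q2 [P2 [F2 QTi P2i]]] : exists Q P,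
    [/\ factored m.+1 T U Q P, Q i ** T i i.+1 = lcols b0 (U i.+1) &
        P i.+1 = rcols b0 (U i.+1)].
  have clQ : lcols b0 (Q i) = lcols b0 (lcols b0 (drop a0 (U i.+1))) by rewrite Qi lcols_takel.
  have F2 := factored_move_right mvR DT F im tC tY CY clQ HWi.
  have tU' := tU; rewrite is_tableauE in tU'.
  exists (update Q i (lcols b0 (drop a0 (U i.+1)))),
         (update P i.+1 (rcols b0 (drop a0 (U i.+1)) ** P i.+1)); split=> //; rewrite update_eq.
    rewrite -{1}clT (lcols_drop _ _ tU') (lcols_take _ _ tU') tprod_drop_take //.
    exact: is_tableau_lcols.
  rewrite Pi (rcols_drop _ _ tU') (rcols_take _ _ tU') tprod_drop_take //.
  exact: is_tableau_rcols.
have {Q P F Qi Pi CY HWi tQP HW tPi TQ TP} [Q0 Pm tQP HW HU'] := F2.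
have tcA := is_tableau_rcols b0 tA.
have crU : rcols b0 (U i.+1) = rcols b0 A ** X by rewrite Ui rcols_tprod // -Ui.
have Xm : i.+1 = m.+1 -> rcols b0 A = [::] /\ X = [::].
  by move=> im1; apply: tprod_eq0 => //; rewrite -crU -P2i im1.
split; last by move=> /Xm[].
apply/(factor_seq_factored _ DT);
  exists (update Q2 i.+1 (X ** Q2 i.+1)), (update P2 i.+1 (rcols b0 A)).
split.
- by rewrite update_neq.
- by rewrite /update; case: eqP => // mi; have [] := Xm (esym mi).
- move=> j jm; have [tQ tP] := tQP j jm; rewrite /update eqSS; split; last by case: eqP.
  by case: eqP => // _; apply: is_tableau_tprod.
- move=> j jm; have [ji|/eqP ji] := eqVneq j i.
    rewrite ji !update_eq update_neq; last by lia.
    by rewrite QTi clU tprod_lcols_rcols.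
  rewrite (update_neq _ _ (_ : j.+1 <> i.+1)); last by lia.
  rewrite (update_neq P2); last by lia.
  have [ji1|/eqP ji1] := eqVneq j i.+1; last by rewrite !update_neq ?HW //; lia.
  have [tQj _] := tQP j jm.
  have tTj : is_tableau (T j j.+1) by have [DT1 _ _] := DT; have [] := DT1 j j.+1; lia.
  by rewrite -ji1 !update_eq HW // !tprodA // is_tableau_tprod.
(* By associativity the bottom sequence is unchanged. *)
- apply: factor_seq_ext HU' => j jm.
  have [->|/eqP ji] := eqVneq j i.+1; last by rewrite !update_neq.
  by rewrite !update_eq P2i crU tprodA.
Qed.

(** Here the canonical factorization is the right starting point: [T i i.+1 ** P i.+1] is the upper
    part [take a A], and [Q i], the lower part, is [X ** drop a A]. Then [X] passes from [Q i] to
    [P i] without changing their product. *)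
Lemma movable_left_succ m : movable_right m -> movable_left m -> movable_left m.+1.
Proof.
move=> mvR mvL a b T U i A X DT HU im tA tX Ui takeU.
have [Q [P F]] := (iffLR (factor_seq_factored U DT)) HU.
case: i im Ui takeU => [|i] // im' Ui takeU; have im : i < m.+1 by lia.
have {Q P F} [Q [P [F Qi Pi clT _]]] := factored_canonical mvR mvL DT F im.
rewrite [i.+1.-1]/= in takeU *.
set a0 := a i i.+1 in Qi Pi clT takeU; set b0 := b i i.+1 in Pi clT.
have tU : is_tableau (U i.+1) by rewrite Ui is_tableau_tprod.
have ttU := is_tableau_take a0 tU; have tdA := is_tableau_drop a0 tA.
have TPi : T i i.+1 ** P i.+1 = take a0 A by rewrite Pi -{1}clT tprod_lcols_rcols.
have {}Qi : Q i = X ** drop a0 A by rewrite Qi Ui drop_tprod // -Ui.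
have [Q0 Pm tQP HW HU'] := F.
have X0 : i = 0 -> X = [::] /\ drop a0 A = [::].
  by move=> i0; apply: tprod_eq0 => //; rewrite -Qi i0.
split; last by move=> [] /X0[].
apply/(factor_seq_factored _ DT); exists (update Q i (drop a0 A)), (update P i (P i ** X)).
have tT j : j < m.+1 -> is_tableau (T j j.+1).
  by move=> jm; have [DT1 _ _] := DT; have [] := DT1 j j.+1; lia.
split.
- by rewrite /update; case: eqP => // i0; have [] := X0 (esym i0).
- by rewrite update_neq //; lia.
- move=> j jm; have [tQ tP] := tQP j jm; rewrite /update; split; first by case: eqP.
  by case: eqP => // <-; apply: is_tableau_tprod.
- move=> j jm; have [ji|/eqP ji] := eqVneq j i.
    have [_ tPi] := tQP i im.
    rewrite ji !update_eq update_neq; last by lia.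
    by rewrite -(tprodA _ tdA (tT i im)) TPi tprod_drop_take.
  rewrite (update_neq _ _ (_ : j.+1 <> i.+1)); last by lia.
  rewrite (update_neq Q) //.
  have [ji1|/eqP ji1] := eqVneq j.+1 i; last by rewrite !update_neq ?HW.
  have [tQj tPj] := tQP j jm; have tTj := tT j jm.
  by rewrite -ji1 !update_eq HW // !tprodA // is_tableau_tprod.
- apply: factor_seq_ext HU' => j jm.
  have [ji|/eqP ji] := eqVneq j i; last by rewrite !update_neq.
  rewrite ji !update_eq Qi tprodA // -ji.
  by have [] := tQP j.-1; [lia | rewrite prednK //; lia].
Qed.

(** The two statements are proved together, since reaching the canonical factorization takes a move
    of each kind one level below. For [m = 0] there is no index to move from. *)
Lemma movable m : movable_right m /\ movable_left m.
Proof.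
elim: m => [|m [mvR mvL]]; last by split; [apply: movable_right_succ | apply: movable_left_succ].
by split=> a b T U i A X _ _; lia.
Qed.

(** In the canonical factorization [Q] is the lower left part times the lower right part, that is,
    [q ** p']. One move of [p'] to the right therefore reaches the given simple factorization. *)
Lemma simple_factored m a b T W Q P i (q p : filling) :
  decreasing_array m.+1 a b T -> factored m.+1 T W Q P -> i < m.+1 ->
  is_tableau (W i.+1) ->
  simple_factorization (a i i.+1) (b i i.+1) (T i i.+1) (W i.+1) q p ->
  exists Q' P', [/\ factored m.+1 T W Q' P', Q' i = q, P' i.+1 = p &
    forall j, j <> i -> Q' j = Q j /\ P' j.+1 = P j.+1].
Proof.
move=> DT F im tW [tq tp Wqp [q' [p' [[tq' tp' Zqp] def_q def_p]]]].
have [mvR mvL] := movable m.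
have [Q1 [P1 [F1 Q1i P1i _ E]]] := factored_canonical mvR mvL DT F im.
set a0 := a i i.+1 in Wqp Zqp def_q def_p Q1i P1i; set b0 := b i i.+1 in Wqp Zqp def_q def_p P1i.
have tdW := is_tableau_drop a0 tW.
have tl := is_tableau_lcols b0 tdW; have tr := is_tableau_rcols b0 (is_tableau_take a0 tW).
have Q1q : Q1 i = q ** p'.
  by rewrite Q1i def_q -tprodA // -Zqp -[LHS](tprod_lcols_rcols b0 tdW).
(* The first [b0] columns of the lower rows form the lower left part. Multiplying it by [q'] and
   then [p'] leaves these columns unchanged, hence so does multiplying by [q'] alone. *)
have clq : lcols b0 (Q1 i) = lcols b0 q.
  have clcl : lcols b0 (lcols b0 (drop a0 (W i.+1))) =
    lcols b0 (drop a0 (W i.+1)) by apply: lcols_takel.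
  rewrite def_q -[lower_left _ _ _]/(lcols b0 (drop a0 (W i.+1))).
  rewrite (lcols_tprod_squeeze (C := p') tl tq') ?clcl ?Q1i //.
  by rewrite -tprodA // -Zqp [X in lcols b0 X](tprod_lcols_rcols b0 tdW).
have F2 := factored_move_right mvR DT F1 im tq tp' Q1q clq.
exists (update Q1 i q), (update P1 i.+1 (p' ** P1 i.+1)); split; rewrite ?update_eq ?P1i //.
  by rewrite -P1i; apply: F2; rewrite P1i -[rcols b0 _]/(upper_right a0 b0 (W i.+1)) -def_p.
by move=> j ji; rewrite !update_neq //; [apply: E | lia].
Qed.

End FactorSequences.

Theorem theorem3 (n : nat) (r : nat -> nat -> nat)
    (T : nat -> nat -> filling) (W P Q : nat -> filling) :
  2 <= n ->
  rank_conditions n r ->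
  tableau_diagram n r T ->
  (forall i, 1 <= i <= n -> is_tableau (W i)) ->
  (forall i, 1 <= i <= n ->
     contains_upper_left (rect_rows r i.-1 i) (rect_cols r i.-1 i)
       (T i.-1 i) (W i)) ->
  (forall i, 1 <= i <= n ->
     simple_factorization (rect_rows r i.-1 i) (rect_cols r i.-1 i)
       (T i.-1 i) (W i) (Q i.-1) (P i)) ->
  factor_sequence n T W <->
  [/\ Q 0 = [::], P n = [::] &
      factor_sequence n.-1 (bottom_rows T) (fun i => P i ** Q i)].
Proof.
case: n => [|[|n]] // _ [_ rk] [shT ltT] tW _ simp.
have DT : decreasing_array n.+2 (rect_rows r) (rect_cols r) T.
  (* The second rank condition, rearranged in two ways, bounds both the number of rows and the
     number of columns. *)
  split=> // i j ijn; have := rk i j ijn; rewrite /rect_rows /rect_cols; lia.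
split.
  move=> /(iffLR (factor_seq_factored W DT))[Q0 [P0 F0]].
  suff [Q' [P' [F E]]] : exists Q' P', factored n.+2 T W Q' P' /\
      forall j, j < n.+2 -> Q' j = Q j /\ P' j.+1 = P j.+1.
    have [Q'0 P'n _ _ HU] := F.
    split; first by have [<-] := E 0 isT.
      by have [_ <-] := E n.+1 (ltnSn _).
    apply: (@factor_seq_ext n.+1 _ _ _ _ HU) => -[|i] // im.
    by have [_ ->] := E i (ltac:(lia)); have [-> _] := E i.+1 (ltac:(lia)).
  (* The factorizations are replaced by the given ones term by term; each replacement at [k] leaves
     the other indices untouched. *)
  suff step : forall k, k <= n.+2 -> exists Q' P', factored n.+2 T W Q' P' /\
      forall j, j < k -> Q' j = Q j /\ P' j.+1 = P j.+1.
    exact: (step n.+2 (leqnn _)).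
  elim=> [_|k IH kn]; first by exists Q0, P0.
  have [Q1 [P1 [F1 E1]]] := IH (ltnW kn).
  have [Q2 [P2 [F2 Q2k P2k E2]]] := simple_factored DT F1 kn (tW k.+1 kn) (simp k.+1 kn).
  exists Q2, P2; split=> // j; rewrite ltnS leq_eqVlt => /predU1P[->|jk] //.
  by have [-> ->] := E2 j (ltac:(lia)); apply: E1.
(* Conversely, the given simple factorizations are themselves the witnesses for the recursive
   clause. *)
move=> [Q0 Pn HU]; apply/(factor_seq_factored W DT); exists Q, P; split=> // i im.
  by have [] := simp i.+1 im.
by have [] := simp i.+1 im.
Qed.
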